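(* Let $(R,\mathfrak{n})$ be a $3$-dimensional regular local ring with $\mathfrak{n} = (X,Y,Z)$, let $\ell \geq 1$ be an integer, and put $A = R/\bigl((X^{\ell}) \cap (Y,Z)\bigr)$. Let $\mathfrak{m}$ be the maximal ideal of $A$ and let $x$ denote the image of $X$ in $A$. Let $Q$ be a parameter ideal in $A$ and $I = Q : \mathfrak{m}$. Then $\ell_A(I/Q) \leq 2$. The equality $I^2 = QI$ holds true if and only if one of the following conditions is satisfied: (1) $\ell \geq 2$. (2) $\ell = 1$ and $\ell_A(I/Q) = 1$. (3) $\ell = 1$, $\ell_A(I/Q) = 2$, and $QB \neq (QB)^{\sharp}$ in $B = A/(x)$. Hence $I^2 = QI$ if either $\ell \geq 2$, or $\ell = 1$ and $Q \subseteq \mathfrak{m}^2$.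
   Context: A parameter ideal in $A$ is an ideal generated by a system of parameters (here $\dim A = 2$). $\ell_A(\cdot)$ denotes length of an $A$-module (not to be confused with the integer $\ell$). For an ideal $\mathfrak{b}$ of a ring $B$, $\mathfrak{b}^{\sharp}$ is its integral closure in $B$. $Q:\mathfrak{m} = \{a\in A \mid a\mathfrak{m}\subseteq Q\}$. *)

(* Defs.v *)
From HB Require Import structures.
From mathcomp Require Import all_boot all_algebra.
From mathcomp Require Import boolp.

Set Implicit Arguments.
Unset Strict Implicit.
Unset Printing Implicit Defensive.

Import GRing.Theory.
Local Open Scope ring_scope.
Local Open Scope quotient_scope.

(* Commutative rings are [comPzRingType]: the zero ring is allowed because
   [idealr] and its quotient rings require a proper ideal, whereas the
   quotients below are defined for every ideal.
   Submodules are the library's [submodClosed V], i.e. boolean predicates;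
   predicates given in Prop are made boolean with [asbool]. *)

Section SubmodOf.
Variables (R : pzRingType) (V : lmodType R) (P : V -> Prop).

Definition submod_axiom := P 0 /\ forall a u v, P u -> P v -> P (a *: u + v).

Definition submod_pred of submod_axiom : {pred V} := fun x => `[< P x >].

Variable hP : submod_axiom.

Lemma submod_pred_closed : submod_closed (submod_pred hP).
Proof.
case: (hP) => P0 PD; split=> [|a u v /asboolP Pu /asboolP Pv]; apply/asboolP=> //.
exact: PD.
Qed.

HB.instance Definition _ :=
  GRing.isSubmodClosed.Build R V (submod_pred hP) submod_pred_closed.

Definition submod_of : submodClosed V := submod_pred hP.

Lemma submod_ofP x : reflect (P x) (x \in submod_of).
Proof. exact: asboolP. Qed.

End SubmodOf.

Definition submod_lt (R : pzRingType) (V : lmodType R) (N N' : submodClosed V) :=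
  {subset N <= N'} /\ ~ {subset N' <= N}.

Section SubModule.
Variables (R : pzRingType) (V : lmodType R) (N : submodClosed V).

Definition submodule : Type := {x : V | x \in N}.
HB.instance Definition _ := SubChoice.on submodule.
HB.instance Definition _ := [SubChoice_isSubLmodule of submodule by <:].

End SubModule.

(* [submodClosed] does not inherit from [zmodClosed], over which the library
   builds quotients. *)
Section SubZmod.
Variables (R : pzRingType) (V : lmodType R) (N : submodClosed V).

Definition zmod_pred : {pred V} := fun x => x \in N.

HB.instance Definition _ := GRing.isZmodClosed.Build V zmod_pred
  (GRing.submod_closedB (submodClosedP N)).

Definition zmod_of : zmodClosed V := zmod_pred.

Lemma mem_zmod_of x : (x \in zmod_of) = (x \in N).
Proof. by []. Qed.

End SubZmod.

Section QuotModule.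
Variables (R : pzRingType) (V : lmodType R) (N : submodClosed V).

Definition quotmod : Type := Quotient.quot (zmod_of N).
HB.instance Definition _ := GRing.Zmodule.on quotmod.

Definition modpi : V -> quotmod := \pi_(Quotient.quot (zmod_of N)).

Lemma modpi_surj x : exists u, x = modpi u.
Proof. by exists (repr x); rewrite /modpi reprK. Qed.

Lemma modpi_eq u v : modpi u = modpi v <-> u - v \in N.
Proof. by rewrite -mem_zmod_of Quotient.idealrBE; split=> /eqP. Qed.

Fact modpi_is_zmod_morphism : zmod_morphism modpi.
Proof. by move=> u v; rewrite /modpi !piE. Qed.

HB.instance Definition _ :=
  GRing.isZmodMorphism.Build V quotmod modpi modpi_is_zmod_morphism.

Definition quotmod_scale (a : R) (x : quotmod) : quotmod :=
  modpi (a *: (repr x : V)).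

Lemma quotmod_scaleE a u : quotmod_scale a (modpi u) = modpi (a *: u).
Proof.
by apply/modpi_eq; rewrite -scalerBr rpredZ //; apply/modpi_eq; rewrite /modpi reprK.
Qed.

Fact quotmod_scaleA a b (x : quotmod) :
  quotmod_scale a (quotmod_scale b x) = quotmod_scale (a * b) x.
Proof. by have [u ->] := modpi_surj x; rewrite !quotmod_scaleE scalerA. Qed.

Fact quotmod_scale1 : left_id 1 quotmod_scale.
Proof. by move=> x; have [u ->] := modpi_surj x; rewrite quotmod_scaleE scale1r. Qed.

Fact quotmod_scaleDr : right_distributive quotmod_scale +%R.
Proof.
move=> a x y; have [u ->] := modpi_surj x; have [v ->] := modpi_surj y.
by rewrite -raddfD !quotmod_scaleE scalerDr raddfD.
Qed.

Fact quotmod_scaleDl x : {morph quotmod_scale^~ x : a b / a + b}.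
Proof.
by move=> a b; have [u ->] := modpi_surj x; rewrite !quotmod_scaleE scalerDl raddfD.
Qed.

HB.instance Definition _ := GRing.Zmodule_isLmodule.Build R quotmod
  quotmod_scaleA quotmod_scale1 quotmod_scaleDr quotmod_scaleDl.

Fact modpi_is_scalable : scalable modpi.
Proof. by move=> a u; rewrite -quotmod_scaleE. Qed.

HB.instance Definition _ :=
  GRing.isScalable.Build R V quotmod *:%R modpi modpi_is_scalable.

End QuotModule.

(* [subquot N N'] is N / (N :&: N'), i.e. N / N' when N' is contained in N. *)
Section SubQuot.
Variables (R : pzRingType) (V : lmodType R) (N N' : submodClosed V).

Fact traceN_subproof : submod_axiom (fun x : submodule N => val x \in N').
Proof.
split=> [|a u v Nu Nv]; first by rewrite raddf0 rpred0.
by rewrite linearP rpredD ?rpredZ.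
Qed.

Definition traceN : submodClosed (submodule N) := submod_of traceN_subproof.

Definition subquot : lmodType R := quotmod traceN.

End SubQuot.

(* The length of V is n: the supremum of the lengths of the strict chains of
   submodules of V is attained and equal to n. *)
Definition submod_chain (R : pzRingType) (V : lmodType R) (n : nat) :=
  exists c : nat -> submodClosed V,
    forall i, (i < n)%N -> submod_lt (c i) (c i.+1).

Definition has_length (R : pzRingType) (V : lmodType R) (n : nat) :=
  submod_chain V n /\ forall k, submod_chain V k -> (k <= n)%N.

(* Ideals of R are the submodules of R as a module over itself. *)
Notation ideal R := (submodClosed R^o).

Section QuotRing.
Variables (R : comPzRingType) (J : ideal R).

Definition quotring : Type := Quotient.quot (zmod_of J).
HB.instance Definition _ := GRing.Zmodule.on quotring.

Definition ringpi (x : R) : quotring := \pi_(Quotient.quot (zmod_of J)) (x : R^o).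

Lemma ringpi_surj x : exists u, x = ringpi u.
Proof. by exists (repr x : R^o); rewrite /ringpi reprK. Qed.

Lemma ringpi_eq u v : ringpi u = ringpi v <-> u - v \in J.
Proof. by rewrite -(mem_zmod_of J) Quotient.idealrBE; split=> /eqP. Qed.

Fact ringpi_is_zmod_morphism : zmod_morphism ringpi.
Proof. by move=> u v; rewrite /ringpi (raddfB (\pi_(Quotient.quot (zmod_of J)))). Qed.

HB.instance Definition _ :=
  GRing.isZmodMorphism.Build R quotring ringpi ringpi_is_zmod_morphism.

Definition quotring_mul (x y : quotring) : quotring :=
  ringpi ((repr x : R^o) * (repr y : R^o)).

Lemma quotring_mulE u v : quotring_mul (ringpi u) (ringpi v) = ringpi (u * v).
Proof.
apply/ringpi_eq; set u' : R := repr _; set v' : R := repr _.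
have Ju : u' - u \in J by apply/ringpi_eq; rewrite /u' /ringpi reprK.
have Jv : v' - v \in J by apply/ringpi_eq; rewrite /v' /ringpi reprK.
have -> : u' * v' - u * v = (u' *: (v' - v : R^o)) + (v *: (u' - u : R^o)).
  by rewrite /GRing.scale /= !mulrBr addrA [v * u']mulrC subrK [v * u]mulrC.
by apply: rpredD; apply: rpredZ.
Qed.

Fact quotring_mulA : associative quotring_mul.
Proof.
move=> x y z; have [u ->] := ringpi_surj x; have [v ->] := ringpi_surj y.
by have [w ->] := ringpi_surj z; rewrite !quotring_mulE mulrA.
Qed.

Fact quotring_mulC : commutative quotring_mul.
Proof.
move=> x y; have [u ->] := ringpi_surj x; have [v ->] := ringpi_surj y.
by rewrite !quotring_mulE mulrC.
Qed.

Fact quotring_mul1 : left_id (ringpi 1) quotring_mul.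
Proof. by move=> x; have [u ->] := ringpi_surj x; rewrite quotring_mulE mul1r. Qed.

Fact quotring_mulDl : left_distributive quotring_mul +%R.
Proof.
move=> x y z; have [u ->] := ringpi_surj x; have [v ->] := ringpi_surj y.
have [w ->] := ringpi_surj z.
by rewrite -raddfD !quotring_mulE mulrDl raddfD.
Qed.

HB.instance Definition _ := GRing.Zmodule_isComPzRing.Build quotring
  quotring_mulA quotring_mulC quotring_mul1 quotring_mulDl.

Fact ringpi_is_monoid_morphism : monoid_morphism ringpi.
Proof. by split=> // u v; rewrite -quotring_mulE. Qed.

HB.instance Definition _ :=
  GRing.isMonoidMorphism.Build R quotring ringpi ringpi_is_monoid_morphism.

End QuotRing.

Section Ideals.
Variable R : comPzRingType.
Implicit Types (I J m : ideal R) (s : seq R).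

Fact ideal1_subproof : submod_axiom (fun _ : R^o => True).
Proof. by []. Qed.

Definition ideal1 : ideal R := submod_of ideal1_subproof.

Fact genI_subproof s : submod_axiom (fun x : R^o =>
  exists c : 'I_(size s) -> R, x = \sum_(i < size s) c i * s`_i).
Proof.
split=> [|a u v [c ->] [d ->]].
  by exists (fun=> 0); rewrite big1 // => i _; rewrite mul0r.
exists (fun i => a * c i + d i); rewrite scaler_sumr -big_split.
by apply: eq_bigr => i _; rewrite mulrDl -mulrA.
Qed.

Definition genI s : ideal R := submod_of (genI_subproof s).

Fact capI_subproof I J : submod_axiom (fun x : R^o => x \in I /\ x \in J).
Proof.
split=> [|a u v [Iu Ju] [Iv Jv]]; first by rewrite !rpred0.
by rewrite !rpredD ?rpredZ.
Qed.

Definition capI I J : ideal R := submod_of (capI_subproof I J).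

Fact mulI_subproof I J : submod_axiom (fun x : R^o =>
  exists n (a b : 'I_n -> R),
    [/\ forall i, a i \in I, forall i, b i \in J & x = \sum_(i < n) a i * b i]).
Proof.
split=> [|r u v [n [a [b [Ia Jb ->]]]] [m [c [d [Ic Jd ->]]]]].
  by exists 0%N, (fun=> 0), (fun=> 0); split; rewrite ?big_ord0 // => -[].
exists (n + m)%N, (fun i => match split i with inl j => r * a j | inr j => c j end),
  (fun i => match split i with inl j => b j | inr j => d j end).
split=> [i|i|]; [by case: split => // j; apply: (rpredZ r (Ia j))|by case: split|].
rewrite big_split_ord scaler_sumr /=; congr (_ + _); apply: eq_bigr => i _.
  by rewrite -[lshift _ _]/(unsplit (inl _)) unsplitK -mulrA.
by rewrite -[rshift _ _]/(unsplit (inr _)) unsplitK.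
Qed.

Definition mulI I J : ideal R := submod_of (mulI_subproof I J).

Definition expI I n : ideal R := iter n (mulI I) ideal1.

Fact colonI_subproof I J :
  submod_axiom (fun x : R^o => forall y : R, y \in J -> x * y \in I).
Proof.
split=> [y _|r u v Iu Iv y Jy]; first by rewrite mul0r rpred0.
by rewrite mulrDl -mulrA rpredD ?Iv // (rpredZ r (Iu y Jy)).
Qed.

Definition colonI I J : ideal R := submod_of (colonI_subproof I J).

(* the set of the x that are integral over I; it is an ideal, but is only used
   here as a set *)
Definition intclosure I : {pred R} := fun x => `[<
  exists2 n, (0 < n)%N & exists2 a : nat -> R,
    forall i, (0 < i <= n)%N -> a i \in expI I i &
    x ^+ n + \sum_(1 <= i < n.+1) a i * x ^+ (n - i) = 0 >].

Definition noetherian := forall I, exists s, I =i genI s.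

Definition prime_ideal I :=
  1 \notin I /\ forall x y : R, x * y \in I -> x \in I \/ y \in I.

Definition maximal_ideal I :=
  1 \notin I /\ forall J, {subset I <= J} -> 1 \notin J -> J =i I.

Definition local_ring m :=
  maximal_ideal m /\ forall m', maximal_ideal m' -> m' =i m.

Definition prime_chain n := exists2 p : nat -> ideal R,
  forall i, (i <= n)%N -> prime_ideal (p i) &
  forall i, (i < n)%N -> submod_lt (p i) (p i.+1).

Definition has_krull_dim d :=
  prime_chain d /\ forall n, prime_chain n -> (n <= d)%N.

Definition regular_local_ring m d :=
  [/\ noetherian, local_ring m, has_krull_dim d &
    exists2 s, size s = d & m =i genI s].

(* For (R, m) local, s is a system of parameters if it consists of dim R
   elements of m and the ideal it generates is m-primary. *)
Definition system_of_parameters m s :=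
  [/\ has_krull_dim (size s), {subset s <= m} &
    forall x : R, x \in m -> exists n, x ^+ n \in genI s].

Definition parameter_ideal m I :=
  exists2 s, system_of_parameters m s & I =i genI s.

End Ideals.

Section Extension.
Variables (R S : comPzRingType) (f : {rmorphism R -> S}) (I : ideal R).

Fact extI_subproof : submod_axiom (fun y : S^o =>
  exists n (b : 'I_n -> S) (a : 'I_n -> R),
    (forall i, a i \in I) /\ y = \sum_(i < n) b i * f (a i)).
Proof.
split=> [|r u v [n [b [a [Ia ->]]]] [m [d [c [Ic ->]]]]].
  by exists 0%N, (fun=> 0), (fun=> 0); split; rewrite ?big_ord0 // => -[].
exists (n + m)%N, (fun i => match split i with inl j => r * b j | inr j => d j end),
  (fun i => match split i with inl j => a j | inr j => c j end).
split=> [i|]; first by case: split.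
rewrite big_split_ord scaler_sumr /=; congr (_ + _); apply: eq_bigr => i _.
  by rewrite -[lshift _ _]/(unsplit (inl _)) unsplitK -mulrA.
by rewrite -[rshift _ _]/(unsplit (inr _)) unsplitK.
Qed.

Definition extI : ideal S := submod_of extI_subproof.

End Extension.

(* Main.v *)
Require Import Defs.
Set Warnings "-notation-overridden,-ambiguous-paths".
From mathcomp Require Import all_boot all_algebra.
From mathcomp Require Import boolp ring.

Set Implicit Arguments.
Unset Strict Implicit.
Unset Printing Implicit Defensive.

Import GRing.Theory.
Local Open Scope ring_scope.

(* Since [J = X^l (Y, Z)], the ideal [x^l A] is isomorphic to the discrete valuation ring
   [R / (Y, Z)] and [A / x^l A = R / (X^l)] is Gorenstein of dimension two.  One can
   choose the generators of [Q] so that [a = x^e + a1 y + a2 z] with [e >= 1] and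
   [b = b1 y + b2 z]; put [Delta = a1 b2 - a2 b1] and [w = x^(l + e - 1)].  The socle of
   [A / Q] is spanned by [w], coming from [x^l A], and possibly by a lift [c] of the
   generator [x^(l - 1) Delta] of the socle of [A / (x^l, a, b)].  Multiplying by [y] and
   [z] shows that such a lift exists if and only if [b1] and [b2] are not units, and then
   [c] can be chosen with [x c = w c = 0].  As [w^2 = a w x^(l - 1)], only [c^2] matters,
   and [c^2 = 0] if [l >= 2].  For [l = 1], [c^2] is in [Q I] if and only if [Delta^2] is
   in [(a, b) (a, b, Delta)] modulo [X].  This is an equation of integral dependence of
   [Delta] over [QB], and [Delta] is not in [QB]; conversely it holds when [a1] and [a2]
   are not units, while [QB] is integrally closed when one of them is a unit.

   That [0], [(X)] and [(X, Y)] are primes of [R], from which the regularity of all the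
   sequences follows, is obtained by bending a prime chain of length 3 through [X] and
   [Y] with the principal ideal theorem and then applying Nakayama's lemma. *)

(** * Ideals *)

Section IdealBasics.
Variable R : comPzRingType.
Implicit Types (I J K : ideal R) (a b c x y u v : R) (s : seq R).

Lemma mem0I I : (0 : R) \in I.
Proof. exact: rpred0. Qed.

Lemma memDI I x y : x \in I -> y \in I -> x + y \in I.
Proof. exact: rpredD. Qed.

Lemma memMl I a x : x \in I -> a * x \in I.
Proof. by move=> Ix; apply: (rpredZ (a : R) Ix). Qed.

Lemma memMr I a x : x \in I -> x * a \in I.
Proof. by rewrite mulrC; apply: memMl. Qed.

Lemma memNI I x : x \in I -> - x \in I.
Proof. by rewrite -mulN1r; apply: memMl. Qed.

Lemma memBI I x y : x \in I -> y \in I -> x - y \in I.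
Proof. by move=> Ix Iy; apply: memDI => //; apply: memNI. Qed.

Lemma memDIr I x y : x \in I -> (x + y \in I) = (y \in I).
Proof.
move=> Ix; apply/idP/idP => [Ixy|]; last exact: memDI.
by rewrite (_ : y = x + y - x); [apply: memBI | ring].
Qed.

Lemma memBIr I x y : x - y \in I -> (x \in I) = (y \in I).
Proof.
move=> Ixy; by rewrite -(@memDIr I (x - y) y) // subrK.
Qed.

Lemma memXI I x k : x \in I -> x ^+ k.+1 \in I.
Proof. by move=> Ix; rewrite exprS; apply: memMr. Qed.

Lemma mem_sumI I (T : finType) (F : T -> R) : (forall i, F i \in I) -> \sum_i F i \in I.
Proof. by move=> IF; apply: rpred_sum => i _; apply: IF. Qed.

Lemma mem1I I x : 1 \in I -> x \in I.
Proof. by move=> I1; rewrite -[x]mulr1; apply: memMl. Qed.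

Lemma mem_submod_of (P : R -> Prop) (hP : @submod_axiom R R^o P) x :
  x \in submod_of hP <-> P x.
Proof. by split=> ?; apply/(submod_ofP hP x). Qed.

Lemma submod_axiomR (P : R -> Prop) : P 0 -> (forall x y, P x -> P y -> P (x + y)) ->
  (forall a x, P x -> P (a * x)) -> @submod_axiom R R^o P.
Proof. by move=> P0 PD PM; split=> // a u v Pu Pv; apply: PD => //; apply: PM. Qed.

Lemma genI_nilP x : x \in genI [::] <-> x = 0.
Proof.
rewrite mem_submod_of; split=> [[c ->]|->]; first by rewrite big_ord0.
by exists (fun=> 0); rewrite big_ord0.
Qed.

Lemma genI_consP a s x :
  x \in genI (a :: s) <-> exists al y, y \in genI s /\ x = al * a + y.
Proof.
rewrite mem_submod_of; split=> [[c ->]|[al [y [/mem_submod_of [c ->] ->]]]].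
  exists (c ord0), (\sum_(i < size s) c (lift ord0 i) * s`_i); split.
    by apply/mem_submod_of; exists (fun i => c (lift ord0 i)).
  by rewrite big_ord_recl.
exists (fun i => if unlift ord0 i is Some j then c j else al).
rewrite big_ord_recl unlift_none; congr (_ + _); apply: eq_bigr => i _.
by rewrite liftK.
Qed.

Lemma genI1P a x : x \in genI [:: a] <-> exists al, x = al * a.
Proof.
rewrite genI_consP; split=> [[al [y [/genI_nilP -> ->]]]|[al ->]].
  by exists al; rewrite addr0.
by exists al, 0; rewrite addr0; split=> //; apply: mem0I.
Qed.

Lemma genI2P a b x : x \in genI [:: a; b] <-> exists al be, x = al * a + be * b.
Proof.
rewrite genI_consP; split=> [[al [y [/genI1P [be ->] ->]]]|[al [be ->]]].
  by exists al, be.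
by exists al, (be * b); split=> //; apply/genI1P; exists be.
Qed.

Lemma genI3P a b c x :
  x \in genI [:: a; b; c] <-> exists al be ga, x = al * a + be * b + ga * c.
Proof.
rewrite genI_consP; split=> [[al [y [/genI2P [be [ga ->]] ->]]]|[al [be [ga ->]]]].
  by exists al, be, ga; rewrite addrA.
exists al, (be * b + ga * c); rewrite addrA; split=> //.
by apply/genI2P; exists be, ga.
Qed.

Lemma mem_genI s a : a \in s -> a \in genI s.
Proof.
elim: s => [//|b s IHs]; rewrite inE => /predU1P [->|/IHs sa]; apply/genI_consP.
  by exists 1, 0; rewrite mul1r addr0; split=> //; apply: mem0I.
by exists 0, a; rewrite mul0r add0r.
Qed.

Lemma genI_sub s I : {subset s <= I} -> {subset genI s <= I}.
Proof.
elim: s => [|b s IHs] sI x; first by move=> /genI_nilP ->; apply: mem0I.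
move=> /genI_consP [al [y [sy ->]]]; apply: memDI.
  by apply: memMl; apply: sI; rewrite mem_head.
by apply: IHs sy => z sz; apply: sI; rewrite inE sz orbT.
Qed.

Lemma genI_eqmem s s' : s =i s' -> genI s =i genI s'.
Proof.
move=> ss' x; apply/idP/idP; apply: genI_sub => y sy; apply: mem_genI.
  by rewrite -ss'.
by rewrite ss'.
Qed.

Lemma capIP I J x : x \in capI I J <-> x \in I /\ x \in J.
Proof. exact: mem_submod_of. Qed.

Lemma colonIP I J x : x \in colonI I J <-> forall y, y \in J -> x * y \in I.
Proof. exact: mem_submod_of. Qed.

Lemma mem_mulI I J x y : x \in I -> y \in J -> x * y \in mulI I J.
Proof.
move=> Ix Jy; apply/mem_submod_of.
by exists 1%N, (fun=> x), (fun=> y); split=> //; rewrite big_ord1.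
Qed.

Lemma mulI_sub I J K :
  (forall x y, x \in I -> y \in J -> x * y \in K) -> {subset mulI I J <= K}.
Proof.
move=> IJK x /mem_submod_of [k [a [b [Ia Jb ->]]]].
by apply: mem_sumI => i; apply: IJK.
Qed.

Lemma expI1 I : expI I 1 =i I.
Proof.
move=> x; apply/idP/idP => [|Ix]; first by apply: mulI_sub => a b Ia _; apply: memMr.
by rewrite -[x]mulr1; apply: mem_mulI => //; apply/mem_submod_of.
Qed.

Lemma mem_expI2 I x y : x \in I -> y \in I -> x * y \in expI I 2.
Proof. by move=> Ix Iy; apply: mem_mulI; rewrite ?expI1. Qed.

Lemma expI2_sub I K :
  (forall x y, x \in I -> y \in I -> x * y \in K) -> {subset expI I 2 <= K}.
Proof.
by move=> IK; apply: (@mulI_sub I (expI I 1)) => x y Ix; rewrite expI1; apply: IK.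
Qed.

(* The set of the [r] with [s * r] in [K + (g)] for some [s] outside [P], i.e.
   the contraction to [R] of the ideal [K + (g)] of the localization at [P]. *)
Definition sat_pred (P K : ideal R) (g r : R) :=
  exists s u v : R, [/\ s \notin P, u \in K & s * r = u + v * g].

Definition saturated (P K : ideal R) :=
  forall s r : R, s \notin P -> s * r \in K -> r \in K.

Lemma prime_notinM (P : ideal R) (s t : R) :
  prime_ideal P -> s \notin P -> t \notin P -> s * t \notin P.
Proof. by move=> [_ prP] Ps Pt; apply/negP => /prP [] st; [move: Ps|move: Pt]; rewrite st. Qed.

Lemma sat_subproof (P K : ideal R) (g : R) : prime_ideal P -> @submod_axiom R R^o (sat_pred P K g).
Proof.
move=> prP; apply: submod_axiomR.
- by exists 1, 0, 0; split; [case: prP | apply: mem0I | rewrite mulr0 mul0r addr0].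
- move=> x y [s [u [v [Ps Ku sx]]]] [s' [u' [v' [Ps' Ku' sy]]]].
  exists (s * s'), (s' * u + s * u'), (s' * v + s * v'); split.
  + exact: prime_notinM.
  + by apply: memDI; apply: memMl.
  + rewrite (_ : _ * _ = s' * (s * x) + s * (s' * y)); last ring.
    by rewrite sx sy; ring.
- move=> a x [s [u [v [Ps Ku sx]]]]; exists s, (a * u), (a * v); split=> //.
  + exact: memMl.
  + by rewrite mulrCA sx; ring.
Qed.

Definition sat (P K : ideal R) (g : R) (prP : prime_ideal P) : ideal R :=
  submod_of (sat_subproof K g prP).

Section Sat.
Variables (P K : ideal R) (g : R) (prP : prime_ideal P).

Lemma mem_satP r : r \in sat K g prP <-> sat_pred P K g r.
Proof. exact: mem_submod_of. Qed.

Lemma sub_sat : {subset K <= sat K g prP}.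
Proof.
by move=> u Ku; apply/mem_satP; exists 1, u, 0; split=> //; [case: prP | rewrite mul1r mul0r addr0].
Qed.

Lemma mem_sat : g \in sat K g prP.
Proof.
apply/mem_satP; exists 1, 0, 1; split; [by case: prP | exact: mem0I | by rewrite add0r].
Qed.

Lemma sat_saturated : saturated P (sat K g prP).
Proof.
move=> s r Ps /mem_satP [s' [u [v [Ps' Ku E]]]]; apply/mem_satP; exists (s' * s), u, v.
by split=> //; [apply: prime_notinM | rewrite -mulrA].
Qed.

End Sat.

Lemma mem_primeX (P : ideal R) x k : prime_ideal P -> x ^+ k \in P -> x \in P.
Proof.
move=> [P1 prP]; elim: k => [|k IHk]; first by rewrite expr0 (negPf P1).
by rewrite exprS => /prP [].
Qed.

End IdealBasics.

(** * Maximal elements in families of ideals; Nakayama's lemma at a prime *)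

Section Noetherian.
Variables (R : comPzRingType) (noethR : noetherian R).
Implicit Types (I J K N P : ideal R).

(** Without a maximal element, choice produces a strictly increasing sequence of ideals; the
    finitely many generators of its union already lie in one term, where the sequence must stop. *)
Lemma noetherian_maximal (Pr : ideal R -> Prop) I0 : Pr I0 ->
  exists I, [/\ Pr I, {subset I0 <= I} &
    forall J, Pr J -> {subset I <= J} -> {subset J <= I}].
Proof.
move=> PrI0; apply: contrapT => noMax.
pose T : Type := {I : ideal R | Pr I /\ {subset I0 <= I}}.
have next (I : T) : {J : T | submod_lt (sval I) (sval J)}.
  apply: cid; case: I => I [PrI I0I] /=; apply: contrapT => noJ.
  case: noMax; exists I; split=> // J PrJ IJ; apply: contrapT => JI.
  by case: noJ; exists (exist _ J (conj PrJ (fun x I0x => IJ x (I0I x I0x)))); split.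
pose c k := iter k (fun I : T => sval (next I)) (exist _ I0 (conj PrI0 (fun x h => h))).
have cS k : submod_lt (sval (c k)) (sval (c k.+1)) by apply: (svalP (next (c k))).
have cle i j : (i <= j)%N -> {subset sval (c i) <= sval (c j)}.
  move=> /subnKC <-; elim: (j - i)%N => [|d IHd] x cx; first by rewrite addn0.
  by rewrite addnS; apply: (cS _).1; apply: IHd.
have unionP : @submod_axiom R R^o (fun x => exists k, x \in sval (c k)).
  apply: submod_axiomR => [|x y [i xi] [j yj]|a x [i xi]].
  - by exists 0%N; apply: mem0I.
  - exists (maxn i j); apply: memDI.
      by apply: cle xi; apply: leq_maxl.
    by apply: cle yj; apply: leq_maxr.
  - by exists i; apply: memMl.
have [s Us] := noethR (submod_of unionP).
have [k sk] : exists k, {subset s <= sval (c k)}.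
  have: {subset s <= submod_of unionP} by move=> x sx; rewrite Us; apply: mem_genI.
  elim: s {Us} => [|a s IHs] sU; first by exists 0%N.
  have [k sk] : exists k, {subset s <= sval (c k)}.
    by apply: IHs => x sx; apply: sU; rewrite inE sx orbT.
  have /mem_submod_of [j aj] := sU a (mem_head _ _).
  exists (maxn j k) => x; rewrite inE => /predU1P [->|/sk xk].
    by apply: cle aj; apply: leq_maxl.
  by apply: cle xk; apply: leq_maxr.
case: (cS k) => _; apply=> x xk; apply: (genI_sub sk).
by rewrite -Us; apply/mem_submod_of; exists k.+1.
Qed.

(** The recursive form lets the coefficient of the first generator be split off when that generator
    is eliminated. *)
Fixpoint lincomb P (gs : seq R) (t : R) : Prop :=
  if gs is g :: gs' then exists2 c, c \in P & lincomb P gs' (t - c * g) else t = 0.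

Lemma lincombD P gs t t' : lincomb P gs t -> lincomb P gs t' -> lincomb P gs (t + t').
Proof.
elim: gs t t' => [t t' /= -> ->|g gs IH t t' [c Pc tc] [c' Pc' tc']] /=.
  by rewrite addr0.
exists (c + c'); first exact: memDI.
by rewrite (_ : _ - _ = t - c * g + (t' - c' * g)); [apply: IH | ring].
Qed.

Lemma lincombM P gs a t : lincomb P gs t -> lincomb P gs (a * t).
Proof.
elim: gs t => [t /= ->|g gs IH t [c Pc tc]] /=; first by rewrite mulr0.
exists (a * c); first exact: memMl.
by rewrite (_ : _ - _ = a * (t - c * g)); [apply: IH | ring].
Qed.

Lemma lincomb_gen P gs x t : x \in P -> t \in genI gs -> lincomb P gs (x * t).
Proof.
move=> Px; elim: gs t => [|g gs IH] t /=; first by move=> /genI_nilP ->; rewrite mulr0.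
move=> /genI_consP [al [y [gy ->]]]; exists (x * al); first exact: memMr.
by rewrite (_ : _ - _ = x * y); [apply: IH | ring].
Qed.

Lemma lincomb_mem P N (gs : seq R) t : {subset gs <= N} -> lincomb P gs t -> t \in N.
Proof.
elim: gs t => [t _ /= ->|g gs IH t gsN [c _ tc]]; first exact: mem0I.
rewrite -(subrK (c * g) t); apply: memDI; last by apply/memMl/gsN/mem_head.
by apply: IH tc => h gsh; apply: gsN; rewrite inE gsh orbT.
Qed.

(** Since [c] is in [P] and [s] is not, [s - c] is a unit at [P], so the relation of the first
    generator serves to eliminate it from the others. Induction puts these in [N], and then the
    first one follows. *)
Lemma lincomb_saturated P N (gs : seq R) : prime_ideal P -> saturated P N ->
    (forall g, g \in gs -> exists s u t,
      [/\ s \notin P, u \in N, lincomb P gs t & s * g = u + t]) ->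
  {subset gs <= N}.
Proof.
move=> prP satN; elim: gs => [//|g gs IH] H.
have [s [u [t [Ps Nu [c Pc tc] sg]]]] := H g (mem_head _ _).
have Psc : s - c \notin P by apply: contra Ps => Psc; rewrite -(subrK c s) memDI.
have gsN : {subset gs <= N}.
  apply: IH => h gsh.
  have [|s' [u' [t' [Ps' Nu' [c' Pc' tc']] sh]]] := H h.
    by rewrite inE gsh orbT.
  exists ((s - c) * s'), ((s - c) * u' + c' * u),
    ((s - c) * (t' - c' * g) + c' * (t - c * g)); split.
  - exact: prime_notinM.
  - by apply: memDI; apply: memMl.
  - by apply: lincombD; apply: lincombM.
  - have {1}-> : u = s * g - t by rewrite sg addrK.
    by rewrite -mulrA sh; ring.
move=> h; rewrite inE => /predU1P [->|/gsN //].
apply: (satN (s - c)) => //.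
rewrite (_ : _ * g = u + (t - c * g)); last by rewrite mulrBl sg addrA.
by apply: memDI => //; apply: lincomb_mem tc.
Qed.

(** Nakayama's lemma for [M] inside [N + x M] in the localization at [P], with the denominators
    written out. *)
Lemma nakayama_saturated P (N M : ideal R) x : prime_ideal P -> saturated P N -> x \in P ->
    (forall g, g \in M -> exists s u t,
      [/\ s \notin P, u \in N, t \in M & s * g = u + x * t]) ->
  {subset M <= N}.
Proof.
move=> prP satN Px H; have [gs Mgs] := noethR M.
suff gsN : {subset gs <= N} by move=> y; rewrite Mgs; apply: genI_sub.
apply: lincomb_saturated prP satN _ => g gsg.
have [|s [u [t [Ps Nu Mt sg]]]] := H g; first by rewrite Mgs mem_genI.
by exists s, u, (x * t); split=> //; apply: lincomb_gen; rewrite -?Mgs.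
Qed.

End Noetherian.

(** * The principal ideal theorem *)

Section KrullPrincipal.
Variables (R : comPzRingType) (noethR : noetherian R).
Implicit Types (I J K N P q : ideal R).

(* A maximal element among the ideals [I : g] is prime. *)
Lemma exists_prime_colon I (S : R -> Prop) g0 : S g0 -> g0 \notin I ->
    (forall u g, S g -> S (u * g)) ->
  exists g (q : ideal R),
    [/\ S g, g \notin I, prime_ideal q & forall r, r \in q <-> r * g \in I].
Proof.
move=> Sg0 Ig0 SM.
have colP g : @submod_axiom R R^o (fun r => r * g \in I).
  apply: submod_axiomR => [|x y Ix Iy|a x Ix].
  - by rewrite mul0r; apply: mem0I.
  - by rewrite mulrDl; apply: memDI.
  - by rewrite -mulrA; apply: memMl.
pose Pr (q : ideal R) := exists g, [/\ S g, g \notin I & forall r, r \in q <-> r * g \in I].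
have [q [[g [Sg Ig qg]] _ qmax]] : exists q, [/\ Pr q, {subset submod_of (colP g0) <= q} &
    forall J, Pr J -> {subset q <= J} -> {subset J <= q}].
  apply: noetherian_maximal => //; exists g0; split=> // r; exact: mem_submod_of.
exists g, q; split=> //; split=> [|x y /qg xyg].
  by apply/negP => /qg; rewrite mul1r; apply/negP.
have [xg|xg] := boolP (x * g \in I); first by left; apply/qg.
(* [I : (x g)] contains the maximal [I : g], hence equals it, and it contains [y]. *)
right; apply: (qmax (submod_of (colP (x * g)))).
- by exists (x * g); split=> //; [apply: SM | move=> r; apply: mem_submod_of].
- by move=> r /qg rg; apply/mem_submod_of; rewrite mulrCA; apply: memMl.
- by apply/mem_submod_of; rewrite mulrA [y * x]mulrC.
Qed.

(** Descending chain condition on the ideals of the localization at [P] that contain [I]; they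
    correspond to saturated ideals of [R]. *)
Definition dcc_above P I := forall K : nat -> ideal R, (forall i, saturated P (K i)) ->
  (forall i, {subset K i.+1 <= K i}) -> (forall i, {subset I <= K i}) ->
  exists i, {subset K i <= K i.+1}.

Lemma decreasing_subset (K : nat -> ideal R) i j :
  (forall i, {subset K i.+1 <= K i}) -> (i <= j)%N -> {subset K j <= K i}.
Proof.
move=> KS /subnKC <-; elim: (j - i)%N => [|d IHd] x; first by rewrite addn0.
by rewrite addnS => /KS /IHd.
Qed.

(* If [P] is minimal over [p0 + (x)], then [R_P / (p0 + (x))] is Artinian. *)
Lemma dcc_minimal_prime (P p0 : ideal R) (x : R) (prP : prime_ideal P) :
    {subset p0 <= P} -> x \in P ->
    (forall q, prime_ideal q -> {subset p0 <= q} -> x \in q -> {subset q <= P} ->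
       {subset P <= q}) ->
  dcc_above P (sat p0 x prP).
Proof.
move=> p0P Px minP; apply: contrapT => ndcc.
(* Noetherian induction on a largest saturated counterexample. *)
pose Pr I := [/\ saturated P I, {subset p0 <= I}, x \in I & ~ dcc_above P I].
have [|I [[satI p0I Ix ndccI] _ Imax]] := @noetherian_maximal R noethR Pr (sat p0 x prP).
  by split=> //; [apply: sat_saturated | apply: sub_sat | apply: mem_sat].
have I1 : 1 \notin I.
  apply/negP => I1; apply: ndccI => K _ _ IK; exists 0%N => y _.
  by apply: mem1I; apply: IK.
(* The prime [q = I : g] contains [p0] and [x], and lies in [P] because [I] is saturated, so [q = P]
   by minimality: modulo [I] and at [P], [g] spans a simple module. *)
have [g [q [_ Ig prq qg]]] := @exists_prime_colon I (fun=> True) 1 Logic.I I1 (fun _ _ => id).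
have {}minP : {subset P <= q}.
  apply: minP => // [y p0y||r /qg rg].
  - by apply/qg/memMr/p0I.
  - by apply/qg/memMr.
  - by apply: contraTT rg => Pr'; apply: contra Ig => /(satI _ _ Pr').
have Pg r : r \in P -> r * g \in I by move=> /minP /qg.
have dccg : dcc_above P (sat I g prP).
  apply: contrapT => ndccg.
  have /Imax H : Pr (sat I g prP).
    split=> //; [exact: sat_saturated| | exact: (sub_sat g prP)].
    by move=> y /p0I; apply: (sub_sat g prP).
  by move/negP: Ig; apply; apply: H; [apply: sub_sat | apply: mem_sat].
apply: ndccI => K satK KS IK.
(* If every [K i] contains [g], the chain lies above [I + (g)]. Otherwise the ideals [K i + (g)]
   stabilize; a coefficient [v] of [g] outside [P] would put [g] in [K i0], so [v g] is in [I]. *)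
have [[i0 Ki0]|Kg] := pselect (exists i, g \notin K i); last first.
  apply: dccg => // i r /mem_satP [s [u [v [Ps Iu sr]]]].
  apply: (satK i s) => //; rewrite sr; apply: memDI; [exact: IK | apply: memMl].
  by apply: contrapT => Kig; apply: Kg; exists i; apply/negP.
have [i Ki] : exists i,
    {subset sat (K (i0 + i)%N) g prP <= sat (K (i0 + i.+1)%N) g prP}.
  apply: (dccg (fun i => sat (K (i0 + i)%N) g prP)).
  - by move=> i; apply: sat_saturated.
  - move=> i r /mem_satP [s [u [v [Ps Ku sr]]]]; apply/mem_satP; exists s, u, v; split=> //.
    by apply: KS; rewrite -addnS.
  - move=> i r /mem_satP [s [u [v [Ps Iu sr]]]]; apply/mem_satP; exists s, u, v; split=> //.
    exact: IK.
exists (i0 + i)%N => r Kr; rewrite -addnS.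
have /mem_satP [s [u [v [Ps Ku sr]]]] := Ki r (sub_sat g prP Kr).
apply: (satK _ s) => //; rewrite sr memDI //; apply: IK.
have [/Pg //|Pv] := boolP (v \in P).
case/negP: Ki0; apply: (satK i0 v) => //.
rewrite -(@memDIr _ _ u) -?sr.
  by apply: memMl; apply: decreasing_subset Kr; rewrite ?leq_addr.
by apply: decreasing_subset Ku; rewrite ?leq_addr.
Qed.

(* Krull's principal ideal theorem: modulo [p0] and localized at [p2], a prime
   minimal over [x] has height at most one.  The powers [y ^+ k] of some [y] in
   [p1] outside [p0] have stationary contractions from the localization at
   [p1]. *)
Lemma prime_between (p0 p1 p2 : ideal R) (x : R) :
    prime_ideal p0 -> prime_ideal p1 -> prime_ideal p2 ->
    submod_lt p0 p1 -> submod_lt p1 p2 -> x \in p2 ->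
  exists q, [/\ prime_ideal q, submod_lt p0 q, submod_lt q p2 & x \in q].
Proof.
move=> pr0 pr1 pr2 lt01 lt12 p2x; apply: contrapT => noq.
have p1x : x \notin p1 by apply/negP => p1x; apply: noq; exists p1.
have [[sub01 n10] [sub12 n21]] := (lt01, lt12).
have minP q : prime_ideal q -> {subset p0 <= q} -> x \in q -> {subset q <= p2} ->
    {subset p2 <= q}.
  move=> prq p0q qx qp2; apply: contrapT => p2q; apply: noq; exists q; split=> //.
  by split=> // qp0; move/negP: p1x; apply; apply/sub01/qp0.
have [y p1y p0y] : exists2 y : R, y \in p1 & y \notin p0.
  apply: contrapT => H; apply: n10 => y p1y; apply: contrapT => p0y.
  by apply: H; exists y => //; apply/negP.
have notp1 s : s \notin p2 -> s \notin p1 by apply: contra; apply: sub12.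
pose I k := sat p0 (y ^+ k) pr1.
have satI k : saturated p1 (I k) by apply: sat_saturated.
have I_S k : {subset I k.+1 <= I k}.
  move=> r /mem_satP [s [u [v [p1s p0u sr]]]]; apply/mem_satP; exists s, u, (v * y).
  by split=> //; rewrite sr exprS mulrA.
have sub02 : {subset p0 <= p2} by move=> z /sub01 /sub12.
have [k Ik] : exists k, {subset sat (I k) x pr2 <= sat (I k.+1) x pr2}.
  apply: (dcc_minimal_prime (prP := pr2) sub02 p2x minP (K := fun k => sat (I k) x pr2)).
  - by move=> i; apply: sat_saturated.
  - move=> i r /mem_satP [s [u [v [p2s Iu sr]]]]; apply/mem_satP; exists s, u, v.
    by split=> //; apply: I_S.
  - move=> i r /mem_satP [s [u [v [p2s p0u sr]]]]; apply/mem_satP; exists s, u, v.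
    by split=> //; apply: sub_sat.
(* Up to a denominator, an element of [I k] is [u + v x] with [u] in [I k.+1]. As [x] is outside
   [p1], [v] is again in [I k], and Nakayama's lemma at [p2] applies. *)
have IkS : {subset I k <= I k.+1}.
  apply: (nakayama_saturated noethR pr2 _ p2x) => [s r /notp1|g Ikg]; first exact: satI.
  have /mem_satP [s [u [v [p2s Iu sg]]]] := Ik g (sub_sat x pr2 Ikg).
  exists s, u, v; split=> //; last by rewrite sg mulrC.
  apply: (satI k x) => //; rewrite mulrC -(@memDIr _ _ u); last exact: I_S.
  by rewrite -sg; apply: memMl.
(* Now [(s - v y) y ^+ k] is in [p0], but neither [y] nor [s - v y] is: [s] is outside [p1] and [y]
   is in [p1]. *)
have /mem_satP [s [u [v [p1s p0u E]]]] := IkS _ (mem_sat p0 (y ^+ k) pr1).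
have : (s - v * y) * y ^+ k \in p0.
  by rewrite mulrBl E exprS mulrA addrK.
move=> /(pr0.2 _ _) [|/(mem_primeX pr0) p0y']; last by rewrite p0y' in p0y.
by move=> /sub01 H; move/negP: p1s; apply; rewrite (memBIr H); apply: memMl.
Qed.

End KrullPrincipal.

(** * Regular local rings of dimension three *)

Section RegularLocalDim3.
Variables (R : comPzRingType) (n : ideal R).
Hypothesis regR : regular_local_ring n 3.
Implicit Types (I J K N p q : ideal R).

Let noethR : noetherian R. Proof. by case: regR. Qed.

Lemma one_notin_max : 1 \notin n.
Proof. by case: regR => _ [[]]. Qed.

Lemma proper_sub_max I : 1 \notin I -> {subset I <= n}.
Proof.
case: regR => _ [_ uniq_n] _ _ I1.
have [K [K1 IK Kmax]] := noetherian_maximal noethR (Pr := fun K => 1 \notin K) I1.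
have Kn : n =i K.
  have maxK : maximal_ideal K.
    split=> // J KJ J1 x; apply/idP/idP; [exact: Kmax | exact: KJ].
  by move=> x; rewrite (uniq_n K).
by move=> x /IK; rewrite Kn.
Qed.

Lemma notin_max_unit u : u \notin n -> exists v, v * u = 1.
Proof.
move=> nu; have : ~~ (1 \notin genI [:: u]).
  by apply: contra nu => /proper_sub_max; apply; apply: mem_genI; rewrite mem_head.
by rewrite negbK => /genI1P [v v1]; exists v.
Qed.

Lemma unit_notin_max u v : v * u = 1 -> u \notin n.
Proof. by move=> vu; apply/negP => /(memMl v); rewrite vu; apply/negP/one_notin_max. Qed.

Lemma max_prime : prime_ideal n.
Proof.
split=> [|x y nxy]; first exact: one_notin_max.
have [|/notin_max_unit [v vx]] := boolP (x \in n); [by left | right].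
by rewrite -[y]mul1r -vx -mulrA; apply: memMl.
Qed.

Lemma max_saturated N : saturated n N.
Proof.
move=> s r /notin_max_unit [v vs] Nsr.
by rewrite -[r]mul1r -vs -mulrA; apply: memMl.
Qed.

Lemma unit_subM u v : v \in n -> exists w, w * (1 - u * v) = 1.
Proof.
move=> nv; apply: notin_max_unit; apply/negP => H; move/negP: one_notin_max; apply.
by rewrite (memBIr H); apply: memMl.
Qed.

Lemma nakayama_max (N M : ideal R) x : x \in n ->
    (forall g, g \in M -> exists u t, [/\ u \in N, t \in M & g = u + x * t]) ->
  {subset M <= N}.
Proof.
move=> nx H; apply: (nakayama_saturated noethR max_prime (@max_saturated N) nx) => g.
move=> /H [u [t [Nu Mt ->]]]; exists 1, u, t; split=> //; first exact: one_notin_max.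
by rewrite mul1r.
Qed.

Lemma prime_eqmem p q : prime_ideal p -> p =i q -> prime_ideal q.
Proof. by move=> [p1 prp] pq; split=> [|x y]; rewrite -!pq //; apply: prp. Qed.

(** In a chain of length 3 the top is enlarged to [n]. Then [prime_between] replaces the third
    prime, next the second, by a prime containing [X], and finally the third by one containing
    [Y]. *)
Lemma prime_flag X Y : X \in n -> Y \in n -> exists p0 p1 p2 : ideal R,
  [/\ [/\ prime_ideal p0, prime_ideal p1 & prime_ideal p2],
      [/\ submod_lt p0 p1, submod_lt p1 p2 & submod_lt p2 n],
      X \in p1 & Y \in p2].
Proof.
case: regR => _ _ [[p prp ltp] _] _ nX nY.
have lt2 : submod_lt (p 2%N) n.
  have [sub23 n32] := ltp 2%N isT; have /proper_sub_max sub3 := (prp 3%N isT).1.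
  split=> [x /sub23 /sub3 //|n2]; apply: n32 => x /sub3; exact: n2.
have [q2 [prq2 lt1q ltqn qX]] :=
  prime_between noethR (prp 1%N isT) (prp 2%N isT) max_prime (ltp 1%N isT) lt2 nX.
have [q1 [prq1 lt0q ltqq qX1]] :=
  prime_between noethR (prp 0%N isT) (prp 1%N isT) prq2 (ltp 0%N isT) lt1q qX.
have [q2' [prq2' ? ? ?]] := prime_between noethR prq1 prq2 max_prime ltqq ltqn nY.
by exists (p 0%N), q1, q2'; split=> //; split=> //; apply: prp.
Qed.

Section Generators.
Variables X Y Z : R.
Hypothesis nXYZ : n =i genI [:: X; Y; Z].

Lemma gen_max : [/\ X \in n, Y \in n & Z \in n].
Proof. by rewrite !nXYZ; split; apply: mem_genI; rewrite !inE eqxx ?orbT. Qed.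

(* A prime chain [p0 < p1 < p2 < n] with [X] in [p1] and [Y] in [p2] must be
   [0 < (X) < (X, Y) < n], by Nakayama. *)
Lemma regular_flag :
  [/\ forall u v : R, u * v = 0 -> u = 0 \/ v = 0,
      prime_ideal (genI [:: X]) /\ X <> 0,
      Y \notin genI [:: X], prime_ideal (genI [:: X; Y]) &
      Z \notin genI [:: X; Y]].
Proof.
have [nX nY nZ] := gen_max.
have [p0 [p1 [p2 [[pr0 pr1 pr2] [[s01 n10] [s12 n21] [s2n nn2]] pX pY]]]] :=
  prime_flag nX nY.
have p2X : X \in p2 by apply: s12.
have p2Z : Z \notin p2.
  apply/negP => p2Z; apply: nn2 => x; rewrite nXYZ; apply: genI_sub => y.
  by rewrite !inE => /or3P [] /eqP ->.
have E2 : p2 =i genI [:: X; Y].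
  (* The coefficient of [Z] in an element of [p2] is in [p2] because [Z] is not, so [p2] is
     contained in [(X, Y) + Z p2]. The smaller primes are treated alike. *)
  have H : {subset p2 <= genI [:: X; Y]}.
    apply: (nakayama_max nZ) => g p2g; move: (s2n _ p2g).
    rewrite nXYZ => /genI3P [al [be [ga E]]].
    exists (al * X + be * Y), ga; split; last by rewrite E [Z * _]mulrC.
      by apply/genI2P; exists al, be.
    have /pr2.2 [] // : ga * Z \in p2.
      rewrite -(@memDIr _ _ (al * X + be * Y)) -?E //.
      by apply: memDI; apply: memMl.
    by move=> p2Z'; rewrite p2Z' in p2Z.
  move=> x; apply/idP/idP; [exact: H | apply: genI_sub => y].
  by rewrite !inE => /orP [] /eqP ->.
have p1Y : Y \notin p1.
  apply/negP => p1Y; apply: n21 => x; rewrite E2; apply: genI_sub => y.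
  by rewrite !inE => /orP [] /eqP ->.
have E1 : p1 =i genI [:: X].
  have H : {subset p1 <= genI [:: X]}.
    apply: (nakayama_max nY) => g p1g; move: (s12 _ p1g).
    rewrite E2 => /genI2P [al [be E]].
    exists (al * X), be; split; last by rewrite E [Y * _]mulrC.
      by apply/genI1P; exists al.
    have /pr1.2 [] // : be * Y \in p1.
      by rewrite -(@memDIr _ _ (al * X)) -?E //; apply: memMl.
    by move=> p1Y'; rewrite p1Y' in p1Y.
  move=> x; apply/idP/idP; [exact: H | apply: genI_sub => y].
  by rewrite !inE => /eqP ->.
have p0X : X \notin p0.
  apply/negP => p0X; apply: n10 => x; rewrite E1; apply: genI_sub => y.
  by rewrite !inE => /eqP ->.
have E0 : p0 =i genI [::].
  have H : {subset p0 <= genI [::]}.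
    apply: (nakayama_max nX) => g p0g; move: (s01 _ p0g).
    rewrite E1 => /genI1P [al E].
    exists 0, al; split; last by rewrite add0r E mulrC.
      exact: mem0I.
    have /pr0.2 [] // : al * X \in p0 by rewrite -E.
    by move=> p0X'; rewrite p0X' in p0X.
  by move=> x; apply/idP/idP; [exact: H | move/genI_nilP ->; exact: mem0I].
split.
- move=> u v uv; have /pr0.2 : u * v \in p0 by rewrite uv; apply: mem0I.
  by rewrite !E0 => -[] /genI_nilP ->; [left | right].
- split; first exact: (prime_eqmem pr1 E1).
  by move=> X0; move/negP: p0X; apply; rewrite X0; apply: mem0I.
- by rewrite -E1.
- exact: (prime_eqmem pr2 E2).
- by rewrite -E2.
Qed.

(* [R / (X, Y)] is a discrete valuation ring with uniformizer [Z]. *)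
Lemma dvr_form f : f \notin genI [:: X; Y] ->
  exists k u v, v * u = 1 /\ f - u * Z ^+ k \in genI [:: X; Y].
Proof.
have [nX nY nZ] := gen_max; set M := genI [:: X; Y] => Mf.
(* Among the factorizations [f = g Z ^+ k] modulo [M], one with [(g, X, Y)] largest is taken. If [g]
   is in [n], then [g = ga Z] modulo [M]; maximality makes [ga] a multiple [h g] modulo [M], so
   [ga (1 - h Z)], hence [ga] and [f], would be in [M]. *)
pose Pr K := exists g k, f - g * Z ^+ k \in M /\ K =i genI [:: g; X; Y].
have [|K [[g [k [Mfg Kg]]] _ Kmax]] := @noetherian_maximal R noethR Pr (genI [:: f; X; Y]).
  by exists f, 0%N; rewrite expr0 mulr1 subrr; split=> //; apply: mem0I.
have [ng|/notin_max_unit [v vg]] := boolP (g \in n); last by exists k, g, v.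
move: ng; rewrite nXYZ => /genI3P [al [be [ga E]]].
have Mag : al * X + be * Y \in M by apply/genI2P; exists al, be.
have Mfga : f - ga * Z ^+ k.+1 \in M.
  rewrite (_ : _ - _ = f - g * Z ^+ k + (al * X + be * Y) * Z ^+ k).
    by apply: memDI => //; apply: memMr.
  by rewrite E exprS; ring.
have /Kmax H : Pr (genI [:: ga; X; Y]) by exists ga, k.+1.
have [h [al' [be' Ega]]] : exists h al' be', ga = h * g + al' * X + be' * Y.
  apply/genI3P; rewrite -Kg; apply: H; last by apply: mem_genI; rewrite mem_head.
  move=> x; rewrite Kg; apply: genI_sub => y; rewrite !inE => /or3P [] /eqP ->.
  - by apply/genI3P; exists Z, al, be; rewrite E; ring.
  - by apply: mem_genI; rewrite !inE eqxx orbT.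
  - by apply: mem_genI; rewrite !inE eqxx !orbT.
have [w w1] := unit_subM h nZ.
have Mga : ga \in M.
  apply/genI2P; exists (w * (h * al + al')), (w * (h * be + be')).
  rewrite -[LHS]mul1r -w1 -mulrA.
  rewrite (_ : (1 - h * Z) * ga = ga - h * (ga * Z)); last by ring.
  by rewrite {1}Ega E; ring.
move/negP: Mf; case; rewrite (memBIr Mfga); exact: memMr.
Qed.

(** * Relations between [a] and [b] modulo powers of [X] *)

Section Koszul.
Variables a b : R.
Hypothesis nb : b \in n.
Hypothesis radXab : forall r, r \in n -> exists k, r ^+ k \in genI [:: X; a; b].

Lemma rad_notin q : prime_ideal q -> submod_lt q n -> X \in q ->
  a \in q -> b \in q -> False.
Proof.
move=> prq [_ nq] qX qa qb; apply: nq => r /radXab [k rk].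
apply: (mem_primeX (k := k) prq); apply: genI_sub rk => y.
by rewrite !inE => /or3P [] /eqP ->.
Qed.

(** [prime_flag] for [X] and [b] gives a prime strictly below [n]; if it contained [a] as well, it
    would contain a power of every element of [n]. *)
Lemma param_notin1 : a \notin genI [:: X].
Proof.
have [nX nY nZ] := gen_max; apply/negP => Xa.
have [p0 [p1 [p2 [[_ _ pr2] [_ [s12 _] lt2n] pX pb]]]] := prime_flag nX nb.
apply: (rad_notin pr2 lt2n) => //; first exact: s12.
by apply: genI_sub Xa => y; rewrite !inE => /eqP ->; apply: s12.
Qed.

(* Depth of [R / (X)]: an associated prime of [(X, a)] containing [b] would
   be [n], and then [Y, Z] would not be a regular sequence. *)
Lemma koszul1 al be : al * a + be * b \in genI [:: X] ->
  exists la, al - la * b \in genI [:: X] /\ be + la * a \in genI [:: X].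
Proof.
have [nX nY nZ] := gen_max; have [_ [prX X0] XY prXY XYZ] := regular_flag => Eab.
have XX : X \in genI [:: X] by apply: mem_genI; rewrite mem_head.
(* Once [be] is a multiple of [a] modulo [X], cancelling [a] in the domain [R / (X)] determines
   [al]. *)
suff /genI2P [la' [mu E]] : be \in genI [:: a; X].
  have Ebe : be + - la' * a \in genI [:: X] by apply/genI1P; exists mu; rewrite E; ring.
  exists (- la'); split=> //; have /prX.2 [] // : (al - - la' * b) * a \in genI [:: X].
    rewrite (_ : _ * _ = al * a + be * b - b * (be + - la' * a)); last by ring.
    by apply: memBI => //; apply: memMl.
  by move=> Xa; move: param_notin1; rewrite Xa.
set N := genI [:: a; X]; apply: contrapT => /negP Nbe.
have Na : a \in N by apply: mem_genI; rewrite mem_head.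
have NX x : x \in genI [:: X] -> x \in N.
  by move=> /genI1P [m ->]; apply/genI2P; exists 0, m; rewrite mul0r add0r.
(* Otherwise some [g] outside [N] with [b g] in [N] has a prime annihilator [q] modulo [N]; it
   contains [X], [a] and [b], hence all of [n]. *)
have [||g [q [Sg Ng prq qg]]] :=
    @exists_prime_colon R noethR N (fun g => b * g \in N) be _ Nbe.
- have : b * be + al * a \in N by apply: NX; rewrite addrC [b * _]mulrC.
  by rewrite addrC memDIr //; apply: memMl.
- by move=> u g Ng; rewrite mulrCA; apply: memMl.
have nq r : r \in n -> r \in q.
  move=> /radXab [k rk]; apply: (mem_primeX (k := k) prq); apply: genI_sub rk => y.
  rewrite !inE => /or3P [] /eqP ->; apply/qg => //; apply: memMr => //; exact: NX.
(* Modulo [X], [Y g = S a] and [Z g = T a]. Cancelling [a] gives [Z S = Y T], so [S = Y S'] and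
   [g = a S'], which would put [g] in [N]. *)
have /qg /genI2P [S [s ES]] := nq _ nY; have /qg /genI2P [T [t ET]] := nq _ nZ.
have XZSYT : Z * S - Y * T \in genI [:: X].
  have /prX.2 [] // : (Z * S - Y * T) * a \in genI [:: X].
    apply/genI1P; exists (Y * t - Z * s).
    have -> : (Z * S - Y * T) * a = Z * (S * a + s * X) - Y * (T * a + t * X)
                                     + (Y * t - Z * s) * X by ring.
    by rewrite -ES -ET; ring.
  by move=> Xa; move: param_notin1; rewrite Xa.
have /prXY.2 [] : Z * S \in genI [:: X; Y].
- move: XZSYT => /genI1P [m Em]; apply/genI2P; exists m, T.
  by rewrite -Em; ring.
- by apply/negP.
move=> /genI2P [s' [S' ES']].
have /prX.2 [/(negP XY) //|Xg] : Y * (g - a * S') \in genI [:: X].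
  apply/genI1P; exists (s' * a + s).
  rewrite mulrBr [Y * g]mulrC -[g * Y]mulrC ES ES'; ring.
move/negP: Ng; apply; rewrite (memBIr (NX _ Xg)); exact: memMr.
Qed.

Lemma mulX_genI l h : X * h \in genI [:: X ^+ l.+1] -> h \in genI [:: X ^+ l].
Proof.
have [dom [_ X0] _ _ _] := regular_flag.
move=> /genI1P [g E]; apply/genI1P; exists g.
have : X * (h - g * X ^+ l) = 0 by rewrite mulrBr E exprS; ring.
by move=> /dom [] // /subr0_eq.
Qed.

(** Modulo [X] the relation is a Koszul relation; subtracting it leaves [X] times a relation modulo
    [X ^+ l], to which induction applies. *)
Lemma koszul l al be : al * a + be * b \in genI [:: X ^+ l] ->
  exists la, al - la * b \in genI [:: X ^+ l] /\ be + la * a \in genI [:: X ^+ l].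
Proof.
elim: l al be => [|l IHl] al be Eab.
  by exists 0; split; apply: mem1I; apply: mem_genI; rewrite expr0 mem_head.
have [|la [/genI1P [al' Eal] /genI1P [be' Ebe]]] := @koszul1 al be.
  by move: Eab => /genI1P [g ->]; apply/genI1P; exists (g * X ^+ l); rewrite exprSr mulrA.
have /mulX_genI /IHl [la' [Ha Hb]] : X * (al' * a + be' * b) \in genI [:: X ^+ l.+1].
  rewrite (_ : X * _ = al * a + be * b); last first.
    rewrite (_ : al = la * b + al' * X); last by rewrite -Eal; ring.
    by rewrite (_ : be = be' * X - la * a); [ring | rewrite -Ebe; ring].
  exact: Eab.
have XM h : h \in genI [:: X ^+ l] -> h * X \in genI [:: X ^+ l.+1].
  by move=> /genI1P [g ->]; apply/genI1P; exists g; rewrite exprSr mulrA.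
exists (la + la' * X); split.
  by rewrite (_ : _ - _ = (al' - la' * b) * X); [apply: XM | rewrite mulrBl -Eal; ring].
by rewrite (_ : _ + _ = (be' + la' * a) * X); [apply: XM | rewrite [RHS]mulrDl -Ebe; ring].
Qed.

End Koszul.
End Generators.
End RegularLocalDim3.

(* Two elements [a], [b] of a two-dimensional regular local domain, written
   [(a, b) = M (y, z)]: the determinant of [M] generates [((a, b) : (y, z))]
   modulo [(a, b)]. *)
Section Determinant.
Variables (D : comPzRingType) (y z a1 a2 b1 b2 : D).
Let a := a1 * y + a2 * z.
Let b := b1 * y + b2 * z.
Let delta := a1 * b2 - a2 * b1.
Hypothesis domD : forall u v : D, u * v = 0 -> u = 0 \/ v = 0.
Hypotheses (y0 : y <> 0) (a0 : a <> 0).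
Hypothesis syz : forall s t : D, z * s = y * t -> exists r, s = y * r.
Hypothesis kos : forall al be : D, al * a + be * b = 0 ->
  exists la, al = la * b /\ be = - (la * a).

Lemma mul_detl : delta * y = b2 * a - a2 * b.
Proof. by rewrite /delta /a /b; ring. Qed.

Lemma mul_detr : delta * z = a1 * b - b1 * a.
Proof. by rewrite /delta /a /b; ring. Qed.

Lemma domD_can (u v w : D) : u <> 0 -> u * v = u * w -> v = w.
Proof.
move=> u0 uvw; have : u * (v - w) = 0 by rewrite mulrBr uvw subrr.
by move=> /domD [] // /subr0_eq.
Qed.

(** Eliminating [t] yields a Koszul relation on [a] and [b]. Expanding these in [y] and [z] turns it
    into two syzygies of [y] and [z], which determine [p] and [q]. *)
Lemma det_socle (t p q r s : D) : t * y = p * a + q * b -> t * z = r * a + s * b ->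
  exists la mu nu, t = la * delta + mu * a + nu * b.
Proof.
move=> ty tz; have [|la [Ep Eq]] := kos (al := z * p - y * r) (be := z * q - y * s).
  rewrite (_ : _ + _ = z * (p * a + q * b) - y * (r * a + s * b)); last by ring.
  by rewrite -ty -tz; ring.
have [|mu Emu] := @syz (p - la * b2) (r + la * b1).
  rewrite (_ : z * _ = z * p - y * r + y * r - la * b2 * z); last by ring.
  by rewrite Ep /b; ring.
have [|nu Enu] := @syz (q + la * a2) (s - la * a1).
  rewrite (_ : z * _ = z * q - y * s + y * s + la * a2 * z); last by ring.
  by rewrite Eq /a; ring.
exists la, mu, nu; apply: (domD_can y0).
rewrite mulrC ty (_ : p = y * mu + la * b2); last by rewrite -Emu subrK.
rewrite (_ : q = y * nu - la * a2); last by rewrite -Enu addrK.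
by rewrite /delta /a /b; ring.
Qed.

(** Multiplying [delta = p a + q b] by [y] and by [z] and comparing with Cramer's rule gives two
    Koszul relations. They imply [a = a (la' y - la z)], and cancelling [a] puts 1 in [(y, z)]. *)
Lemma det_notin (p q : D) : (forall u v : D, u * y + v * z <> 1) -> delta <> p * a + q * b.
Proof.
move=> loc Ed.
have [|la [Ea Eb]] := kos (al := p * y - b2) (be := q * y + a2).
  rewrite (_ : _ + _ = (p * a + q * b) * y - (b2 * a - a2 * b)); last by ring.
  by rewrite -Ed mul_detl subrr.
have [|la' [Ea' Eb']] := kos (al := p * z + b1) (be := q * z - a1).
  rewrite (_ : _ + _ = (p * a + q * b) * z - (a1 * b - b1 * a)); last by ring.
  by rewrite -Ed mul_detr subrr.
apply: (loc la' (- la)).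
have : a * (la' * y + - la * z) = a * 1.
  have -> : a * 1 = (q * z - (q * z - a1)) * y + (q * y + a2 - q * y) * z.
    by rewrite /a; ring.
  by rewrite Eb Eb'; ring.
exact: domD_can.
Qed.

(* In [Delta ^ 2 = al * a + be * b], multiplying by [y] and [z] and comparing
   coefficients shows that [al] and [be] lie in [(a, b) : (y, z)]. *)
Lemma det_sqr (a11 a12 a21 a22 b11 b12 b21 b22 : D) :
    a1 = a11 * y + a12 * z -> a2 = a21 * y + a22 * z ->
    b1 = b11 * y + b12 * z -> b2 = b21 * y + b22 * z ->
  exists al be, [/\ delta ^+ 2 = al * a + be * b,
    exists la mu nu, al = la * delta + mu * a + nu * b &
    exists la mu nu, be = la * delta + mu * a + nu * b].
Proof.
move=> Ea1 Ea2 Eb1 Eb2.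
have det_lin u v : delta * (u * y + v * z) =
    (u * b2 - v * b1) * a + (v * a1 - u * a2) * b.
  rewrite (_ : _ * _ = u * (delta * y) + v * (delta * z)); last by ring.
  by rewrite mul_detl mul_detr; ring.
have da1 := det_lin a11 a12; have da2 := det_lin a21 a22.
have db1 := det_lin b11 b12; have db2 := det_lin b21 b22.
rewrite -Ea1 in da1; rewrite -Ea2 in da2; rewrite -Eb1 in db1; rewrite -Eb2 in db2.
(* Coefficients of [a] and [b] in [a1 (delta b2) - a2 (delta b1)] after expanding both products by
   [det_lin]. *)
pose al := a1 * (b21 * b2 - b22 * b1) - a2 * (b11 * b2 - b12 * b1).
pose be := a1 * (b22 * a1 - b21 * a2) - a2 * (b12 * a1 - b11 * a2).
have dd : delta ^+ 2 = al * a + be * b.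
  rewrite (_ : delta ^+ 2 = a1 * (delta * b2) - a2 * (delta * b1)).
    by rewrite db1 db2 /al /be; ring.
  by rewrite /delta; ring.
(* Since [delta y = b2 a - a2 b], there are two expressions for [delta ^+ 2 * y]. They differ by a
   Koszul relation, so [al y] is [delta b2] up to a multiple of [b]. *)
have [|la [Ela Elb]] := kos (al := al * y - delta * b2) (be := be * y + delta * a2).
  rewrite (_ : _ + _ = (al * a + be * b) * y - delta * (b2 * a - a2 * b)); last by ring.
  by rewrite -dd -mul_detl; ring.
have [|la' [Ela' Elb']] := kos (al := al * z + delta * b1) (be := be * z - delta * a1).
  rewrite (_ : _ + _ = (al * a + be * b) * z - delta * (a1 * b - b1 * a)); last by ring.
  by rewrite -dd -mul_detr; ring.
exists al, be; split=> //.
- apply: (@det_socle al (b21 * b2 - b22 * b1) (b22 * a1 - b21 * a2 + la)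
    (- (b11 * b2 - b12 * b1)) (la' - (b12 * a1 - b11 * a2))).
    by rewrite -(subrK (delta * b2) (al * y)) Ela db2; ring.
  by rewrite -(addrK (delta * b1) (al * z)) Ela' db1; ring.
- apply: (@det_socle be (- la - (a21 * b2 - a22 * b1)) (- (a22 * a1 - a21 * a2))
    (a11 * b2 - a12 * b1 - la') (a12 * a1 - a11 * a2)).
    by rewrite -(addrK (delta * a2) (be * y)) Elb da2; ring.
  by rewrite -(subrK (delta * a1) (be * z)) Elb' da1; ring.
Qed.

End Determinant.

(** * Normal form of the generators, and the socle modulo [(X^(l + 1), a, b)] *)

Section ParameterIdeal.
Variables (R : comPzRingType) (n : ideal R).
Hypothesis regR : regular_local_ring n 3.
Variables X Y Z : R.
Hypothesis nXYZ : n =i genI [:: X; Y; Z].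


Lemma gen_max_perm X' Y' Z' : perm_eq [:: X; Y; Z] [:: X'; Y'; Z'] ->
  n =i genI [:: X'; Y'; Z'].
Proof. by move=> /perm_mem E x; rewrite nXYZ (genI_eqmem E). Qed.

Lemma genYZ_prime : prime_ideal (genI [:: Y; Z]) /\ X \notin genI [:: Y; Z].
Proof.
have E : n =i genI [:: Y; Z; X].
  by apply: gen_max_perm; rewrite perm_sym -(perm_rot 2).
by have [_ _ _ ? ?] := regular_flag regR E.
Qed.

Lemma mulX_YZ k g : X ^+ k * g \in genI [:: Y; Z] -> g \in genI [:: Y; Z].
Proof.
have [prYZ XYZ] := genYZ_prime.
by move=> /prYZ.2 [/(mem_primeX prYZ)|//]; rewrite (negPf XYZ).
Qed.

Lemma genYZ_sub (I : ideal R) x : Y \in I -> Z \in I -> x \in genI [:: Y; Z] -> x \in I.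
Proof.
by move=> IY IZ; apply: genI_sub => y; rewrite !inE => /orP [] /eqP ->.
Qed.

Lemma mem_capX k r : r \in capI (genI [:: X ^+ k]) (genI [:: Y; Z]) <->
  exists2 g, g \in genI [:: Y; Z] & r = X ^+ k * g.
Proof.
split=> [/capIP [/genI1P [g ->]]|[g YZg ->]].
  by rewrite mulrC => /mulX_YZ YZg; exists g.
apply/capIP; split; last exact: memMl.
by apply/genI1P; exists g; rewrite mulrC.
Qed.

(* In the valuation ring [R / (Y, Z)] one of the two elements divides the other. *)
Lemma normal_form_aux (r0 r1 : R) (u v v' : R) i j : r0 \in n -> (i <= j)%N -> v' * u = 1 ->
    r0 - u * X ^+ i \in genI [:: Y; Z] -> r1 - v * X ^+ j \in genI [:: Y; Z] ->
  exists e a1 a2 b1 b2, genI [:: r0; r1] =i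
    genI [:: X ^+ e.+1 + a1 * Y + a2 * Z; b1 * Y + b2 * Z].
Proof.
have [nX nY nZ] := gen_max nXYZ => nr0 ij vu /genI2P [p [q E0]] /genI2P [p' [q' E1]].
have nYZ x : x \in genI [:: Y; Z] -> x \in n by apply: genYZ_sub.
case: i => [|e] in ij E0 *.
  move/negP: (unit_notin_max regR vu); case.
  rewrite -(memBIr (x := r0)) // -[u]mulr1 -(expr0 X) E0.
  by apply: nYZ; apply/genI2P; exists p, q.
have {}E0 : r0 = u * X ^+ e.+1 + p * Y + q * Z by rewrite -addrA -E0 addrC subrK.
have {}E1 : r1 = v * X ^+ j + p' * Y + q' * Z by rewrite -addrA -E1 addrC subrK.
(* In [R / (Y, Z)], [h] is the quotient of [r1] by [a], so [r1 - h a] is in [(Y, Z)]. *)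
pose h := v * X ^+ (j - e.+1).
have Ej : v * X ^+ j = h * X ^+ e.+1 by rewrite -mulrA -exprD subnK.
exists e, (v' * p), (v' * q), (p' - h * (v' * p)), (q' - h * (v' * q)).
set a := _ + _ + _; set b := _ + _.
have Ea : a = v' * r0.
  by rewrite /a E0 -[X ^+ e.+1]mul1r -{1}vu; ring.
have Eb : b = r1 - h * a by rewrite /a /b E1 Ej; ring.
have E0' : r0 = u * a by rewrite Ea mulrA [u * v']mulrC vu mul1r.
move=> x; apply/idP/idP; apply: genI_sub => y; rewrite !inE => /orP [] /eqP ->.
- by apply/genI2P; exists u, 0; rewrite E0' mul0r addr0.
- by apply/genI2P; exists h, 1; rewrite Eb mul1r addrC subrK.
- by apply/genI2P; exists v', 0; rewrite Ea mul0r addr0.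
- by apply/genI2P; exists (- h * v'), 1; rewrite Eb Ea; ring.
Qed.

Lemma normal_form (r0 r1 : R) : r0 \in n -> r1 \in n ->
    ~ (r0 \in genI [:: Y; Z] /\ r1 \in genI [:: Y; Z]) ->
  exists e a1 a2 b1 b2, genI [:: r0; r1] =i
    genI [:: X ^+ e.+1 + a1 * Y + a2 * Z; b1 * Y + b2 * Z].
Proof.
wlog r0YZ : r0 r1 / r0 \notin genI [:: Y; Z].
  move=> H nr0 nr1 r01; have [r0YZ|] := boolP (r0 \in genI [:: Y; Z]); last first.
    by move=> r0YZ; apply: H.
  have [||e [a1 [a2 [b1 [b2 E]]]]] := H r1 r0 _ nr1 nr0.
  - by apply/negP => r1YZ; apply: r01.
  - by move=> [r1YZ _]; apply: r01.
  exists e, a1, a2, b1, b2 => x; rewrite -E; apply: genI_eqmem => y.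
  by rewrite !inE orbC.
have dvr r : r \notin genI [:: Y; Z] ->
    exists k u v, v * u = 1 /\ r - u * X ^+ k \in genI [:: Y; Z].
  by apply: (dvr_form regR); apply: gen_max_perm; rewrite perm_sym -(perm_rot 2).
move=> nr0 nr1 _; have [i [u [v' [vu Ei]]]] := dvr _ r0YZ.
have [r1YZ|/dvr [j [v [w [wv Ej]]]]] := boolP (r1 \in genI [:: Y; Z]).
  (* An element of [(Y, Z)] is given the coefficient 0 and the same exponent [i]. *)
  by apply: (@normal_form_aux r0 r1 u 0 v' i i) => //; rewrite mul0r subr0.
have [ij|/ltnW ji] := leqP i j; first exact: (@normal_form_aux r0 r1 u v v' i j).
have [e [a1 [a2 [b1 [b2 E]]]]] := normal_form_aux nr1 ji wv Ej Ei.
exists e, a1, a2, b1, b2 => x; rewrite -E; apply: genI_eqmem => y.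
by rewrite !inE orbC.
Qed.

Variables (e : nat) (a1 a2 b1 b2 : R).
Let a := X ^+ e.+1 + a1 * Y + a2 * Z.
Let b := b1 * Y + b2 * Z.
Let delta := a1 * b2 - a2 * b1.
Hypothesis radXab : forall r, r \in n -> exists k, r ^+ k \in genI [:: X; a; b].

Let nb : b \in n.
Proof. by have [nX nY nZ] := gen_max nXYZ; rewrite /b memDI //; apply: memMl. Qed.

(** The domain in which the determinant lemmas are applied; there [a] loses its power of [X]. *)
Let D : comPzRingType := quotring (genI [:: X]).
Let pi : {rmorphism R -> D} := @ringpi R (genI [:: X]).

Lemma ringpi_eq0 r : pi r = 0 <-> r \in genI [:: X].
Proof. by rewrite -(rmorph0 pi) (ringpi_eq (genI [:: X])) subr0. Qed.

Lemma piX : pi X = 0.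
Proof. by apply/ringpi_eq0; apply: mem_genI; rewrite mem_head. Qed.

Lemma ringpi_eqX r s : pi r = pi s -> exists h, r = s + X * h.
Proof.
move=> /(ringpi_eq (genI [:: X])) /genI1P [h E].
by exists h; rewrite mulrC -E addrC subrK.
Qed.

Let pia : pi a = pi a1 * pi Y + pi a2 * pi Z.
Proof. by rewrite /a !rmorphD !rmorphM rmorphXn piX expr0n add0r. Qed.

Let pib : pi b = pi b1 * pi Y + pi b2 * pi Z.
Proof. by rewrite /b !rmorphD !rmorphM. Qed.

Let pid : pi delta = pi a1 * pi b2 - pi a2 * pi b1.
Proof. by rewrite /delta rmorphB !rmorphM. Qed.

Let domD (u v : D) : u * v = 0 -> u = 0 \/ v = 0.
Proof.
have [_ [[_ prX] _] _ _ _] := regular_flag regR nXYZ.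
have [u' ->] := ringpi_surj u; have [v' ->] := ringpi_surj v.
by rewrite -rmorphM => /ringpi_eq0 /prX [] /ringpi_eq0; [left | right].
Qed.

Let piY0 : pi Y <> 0.
Proof. by have [_ _ /negP XY _ _] := regular_flag regR nXYZ => /ringpi_eq0. Qed.

Let pia0 : pi a1 * pi Y + pi a2 * pi Z <> 0.
Proof.
rewrite -pia => /ringpi_eq0; apply/negP; exact: (param_notin1 regR nXYZ nb radXab).
Qed.

Let syzD (s t : D) : pi Z * s = pi Y * t -> exists r, s = pi Y * r.
Proof.
have [_ _ _ prXY XYZ] := regular_flag regR nXYZ.
have [s' ->] := ringpi_surj s; have [t' ->] := ringpi_surj t.
rewrite -!rmorphM => /ringpi_eqX [h E].
have /prXY.2 [] : Z * s' \in genI [:: X; Y].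
- by apply/genI2P; exists h, t'; rewrite E; ring.
- by rewrite (negPf XYZ).
move=> /genI2P [p [q Es]]; exists (pi q).
by rewrite -rmorphM [ringpi _ _](_ : _ = pi s') // Es rmorphD !rmorphM piX mulr0 add0r mulrC.
Qed.

Let kosD (al be : D) :
    al * (pi a1 * pi Y + pi a2 * pi Z) + be * (pi b1 * pi Y + pi b2 * pi Z) = 0 ->
  exists la, al = la * (pi b1 * pi Y + pi b2 * pi Z) /\
             be = - (la * (pi a1 * pi Y + pi a2 * pi Z)).
Proof.
rewrite -pia -pib.
have [al' ->] := ringpi_surj al; have [be' ->] := ringpi_surj be.
rewrite -!rmorphM -rmorphD => /ringpi_eq0 /(koszul1 regR nXYZ nb radXab).
move=> [la [/ringpi_eq0 E1 /ringpi_eq0 E2]]; exists (pi la); split.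
  by move: E1; rewrite rmorphB rmorphM => /subr0_eq.
by move: E2; rewrite rmorphD rmorphM => /eqP; rewrite addr_eq0 => /eqP.
Qed.

Lemma locD (u v : D) : u * pi Y + v * pi Z <> 1.
Proof.
have [nX nY nZ] := gen_max nXYZ.
have [u' ->] := ringpi_surj u; have [v' ->] := ringpi_surj v.
rewrite -!rmorphM -rmorphD -(rmorph1 pi) => /ringpi_eqX [h E].
move/negP: (one_notin_max regR); apply.
rewrite -(@memDIr _ n (X * h) 1) ?memMr // addrC -E memDI //; exact: memMl.
Qed.

(** [al] and [be] form a relation modulo [X ^+ l], so up to multiples of [X ^+ l] they are a Koszul
    pair, which contributes nothing to [al a + be b]; then [X ^+ l] cancels. *)
Lemma param_strip l s : X ^+ l * s \in genI [:: X ^+ l.+1; a; b] ->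
  exists al be h, s = al * a + be * b + X * h.
Proof.
have [dom [_ X0] _ _ _] := regular_flag regR nXYZ.
move=> /genI3P [h [al [be E]]].
have [|la [/genI1P [al' Eal] /genI1P [be' Ebe]]] :=
    @koszul _ _ regR _ _ _ nXYZ _ _ nb radXab l al be.
  by apply/genI1P; exists (s - h * X); rewrite mulrBl [s * _]mulrC E exprS; ring.
exists al', be', h; apply/subr0_eq.
have : X ^+ l * (s - (al' * a + be' * b + X * h)) = 0.
  rewrite mulrBr E (_ : al = la * b + al' * X ^+ l); last by rewrite -Eal; ring.
  rewrite (_ : be = be' * X ^+ l - la * a); last by rewrite -Ebe; ring.
  by rewrite exprS; ring.
elim: (l) => [|k IHk]; first by rewrite expr0 mul1r.
by rewrite exprS -mulrA => /dom [] // /IHk.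
Qed.

(** Being killed by [X] already makes [t] equal to [X ^+ l * t'] modulo [(a, b)]. By [param_strip],
    [Y] and [Z] kill [t'] modulo [(X, a, b)], and [det_socle] applies. *)
Lemma socle_gen l t : (forall r, r \in n -> t * r \in genI [:: X ^+ l.+1; a; b]) ->
  exists la f al be, t = la * (X ^+ l * delta) + X ^+ l.+1 * f + (al * a + be * b).
Proof.
have [nX nY nZ] := gen_max nXYZ.
have [dom [_ X0] _ _ _] := regular_flag regR nXYZ => nt.
have [t' [al [be Et]]] : exists t' al be, t = X ^+ l * t' + (al * a + be * b).
  have /genI3P [g [al [be E]]] := nt _ nX.
  have [|la [/genI1P [al' Eal] /genI1P [be' Ebe]]] :=
      @koszul1 _ _ regR _ _ _ nXYZ _ _ nb radXab al be.
    by apply/genI1P; exists (t - g * X ^+ l); rewrite mulrBl E exprS; ring.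
  exists g, al', be'; apply/subr0_eq.
  have /dom [] // : X * (t - (X ^+ l * g + (al' * a + be' * b))) = 0.
  rewrite mulrBr [X * t]mulrC E (_ : al = la * b + al' * X); last by rewrite -Eal; ring.
  rewrite (_ : be = be' * X - la * a); last by rewrite -Ebe; ring.
  by rewrite exprS; ring.
have strip r : r \in n -> exists al be h, t' * r = al * a + be * b + X * h.
  move=> /nt /genI3P [p [q [s E]]]; apply: (@param_strip l).
  apply/genI3P; exists p, (q - al * r), (s - be * r).
  have -> : X ^+ l * (t' * r) = t * r - (al * a + be * b) * r by rewrite Et; ring.
  by rewrite E; ring.
have [p [q [hy Ey]]] := strip _ nY; have [r [s [hz Ez]]] := strip _ nZ.
have [||la [mu [nu E]]] :=
    @det_socle D (pi Y) (pi Z) _ _ _ _ domD piY0 syzD kosD (pi t') (pi p) (pi q) (pi r) (pi s).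
- rewrite -pia -pib -!rmorphM Ey rmorphD [pi (X * hy)]rmorphM piX mul0r addr0.
  by rewrite -rmorphD.
- rewrite -pia -pib -!rmorphM Ez rmorphD [pi (X * hz)]rmorphM piX mul0r addr0.
  by rewrite -rmorphD.
move: E; rewrite -pia -pib -pid.
have [la' ->] := ringpi_surj la; have [mu' ->] := ringpi_surj mu.
have [nu' ->] := ringpi_surj nu.
rewrite -!rmorphM -!rmorphD => /ringpi_eqX [h E].
exists la', h, (al + X ^+ l * mu'), (be + X ^+ l * nu'); by rewrite Et E exprS; ring.
Qed.

Lemma socle_notin l : X ^+ l * delta \notin genI [:: X ^+ l.+1; a; b].
Proof.
apply/negP => /param_strip [al [be [h E]]].
apply: (@det_notin D (pi Y) (pi Z) (pi a1) (pi a2) (pi b1) (pi b2) domD _ kosD (pi al) (pi be)).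
- exact: pia0.
- exact: locD.
rewrite -pia -pib -pid E (rmorphD pi (al * a + be * b)) (rmorphD pi (al * a)).
by rewrite (rmorphM pi al) (rmorphM pi be) (rmorphM pi X) piX mul0r addr0.
Qed.

Lemma delta_sqr : [/\ a1 \in n, a2 \in n, b1 \in n & b2 \in n] ->
  exists al be h, delta ^+ 2 = al * a + be * b + X * h /\
    (exists la mu nu k, al = la * delta + mu * a + nu * b + X * k) /\
    (exists la mu nu k, be = la * delta + mu * a + nu * b + X * k).
Proof.
have nlin c : c \in n -> exists u v, pi c = pi u * pi Y + pi v * pi Z.
  rewrite nXYZ => /genI3P [p [q [r ->]]]; exists q, r.
  by rewrite !rmorphD !rmorphM piX mulr0 add0r.
move=> [/nlin [? [? Ea1]] /nlin [? [? Ea2]] /nlin [? [? Eb1]] /nlin [? [? Eb2]]].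
have [al [be [E [la [mu [nu Eal]]] [la' [mu' [nu' Ebe]]]]]] :=
  @det_sqr D (pi Y) (pi Z) _ _ _ _ domD piY0 syzD kosD _ _ _ _ _ _ _ _ Ea1 Ea2 Eb1 Eb2.
move: E Eal Ebe; rewrite -pia -pib -pid.
have [al' ->] := ringpi_surj al; have [be' ->] := ringpi_surj be.
have [laR ->] := ringpi_surj la; have [muR ->] := ringpi_surj mu.
have [nuR ->] := ringpi_surj nu.
have [laR' ->] := ringpi_surj la'; have [muR' ->] := ringpi_surj mu'.
have [nuR' ->] := ringpi_surj nu'.
rewrite -!rmorphM -rmorphXn -!rmorphD => /ringpi_eqX [h E] /ringpi_eqX [k Ek].
move=> /ringpi_eqX [k' Ek']; exists al', be', h; split=> //; split.
  by exists laR, muR, nuR, k.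
by exists laR', muR', nuR', k'.
Qed.

End ParameterIdeal.

(** * The length of the socle *)

Section SocleLength.
Variables (A : comPzRingType) (m : ideal A).
Hypothesis m1 : 1 \notin m.
Hypothesis m_unit : forall t, t \notin m -> exists v, v * t = 1.

Section Chains.
Variable V : lmodType A.
Implicit Types (c : nat -> submodClosed V) (g h : V).

Lemma submodB (N : submodClosed V) g h : g \in N -> h \in N -> g - h \in N.
Proof. by move=> Ng Nh; rewrite -scaleN1r rpredD ?rpredZ. Qed.

Lemma unit_scale (N : submodClosed V) (r : A) g : r \notin m -> r *: g \in N -> g \in N.
Proof.
move=> /m_unit [v vr] Ng; rewrite -[g]scale1r -vr -scalerA; exact: rpredZ.
Qed.

Lemma chain_step (N N' : submodClosed V) : submod_lt N N' -> exists2 u, u \in N' & u \notin N.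
Proof.
move=> [_ NN']; apply: contrapT => H; apply: NN' => u N'u; apply: contrapT => /negP Nu.
by apply: H; exists u.
Qed.

(** An element of [c 1] outside [c 0] involves [g] with a unit coefficient, so [c 1] is everything.
    The hypotheses are relative to [c 0] rather than to 0 so that [chain_le2] can use a shifted
    chain. *)
Lemma chain_le1 c k g : (forall i, (i < k)%N -> submod_lt (c i) (c i.+1)) ->
    (forall r, r \in m -> r *: g \in c 0%N) ->
    (forall u, exists u0 r, u0 \in c 0%N /\ u = u0 + r *: g) ->
  (k <= 1)%N.
Proof.
case: k => [|[|k]] // lt mg gen; exfalso.
have [u u1 u0] := chain_step (lt 0%N isT).
have sub01 := (lt 0%N isT).1.
have g1 : g \in c 1%N.
  have [u' [r [u'0 E]]] := gen u; have [/mg rg|rm] := boolP (r \in m).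
    by move: u0; rewrite E rpredD.
  apply: (unit_scale rm); rewrite (_ : r *: g = u - u'); last by rewrite E addrC addKr.
  by apply: submodB => //; apply: sub01.
have [v _ v1] := chain_step (lt 1%N isT); move/negP: v1; apply.
have [u' [r [u'0 ->]]] := gen v; apply: rpredD; [exact: sub01 | exact: rpredZ].
Qed.

(** An element of [c 1] outside [c 0] involves [g] or [h] with a unit coefficient. Modulo [c 1] that
    generator is redundant, and [chain_le1] bounds the rest of the chain. *)
Lemma chain_le2 c k g h : (forall i, (i < k)%N -> submod_lt (c i) (c i.+1)) ->
    (forall r, r \in m -> r *: g \in c 0%N /\ r *: h \in c 0%N) ->
    (forall u, exists u0 r s, u0 \in c 0%N /\ u = u0 + r *: g + s *: h) ->
  (k <= 2)%N.
Proof.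
case: k => [|k] // lt mgh gen.
have [u u1 u0] := chain_step (lt 0%N isT).
have sub01 := (lt 0%N isT).1.
have [u' [r [s [u'0 E]]]] := gen u.
have lt' i : (i < k)%N -> submod_lt (c i.+1) (c i.+2) by move=> ik; apply: lt.
have [/mgh [rg _]|rm] := boolP (r \in m); last first.
  apply: (chain_le1 (c := fun i => c i.+1) (g := h) lt') => [t /mgh [_ /sub01] //|v].
  have [w wr] := m_unit rm; have [v' [p [q [v'0 ->]]]] := gen v.
  exists (v' + (p * w) *: (u - u')), (q - p * w * s); split.
    apply: rpredD; first exact: sub01.
    by apply/rpredZ/submodB => //; apply: sub01.
  have -> : u - u' = r *: g + s *: h by apply/eqP; rewrite subr_eq E -addrA addrC.
  rewrite scalerDr !scalerA -mulrA wr mulr1 -!addrA; congr (_ + (_ + _)).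
  by rewrite -scalerDl; congr (_ *: _); ring.
have [/mgh [_ sh]|sm] := boolP (s \in m).
  by move: u0; rewrite E !rpredD.
apply: (chain_le1 (c := fun i => c i.+1) (g := g) lt') => [t /mgh [/sub01] //|v].
have [w ws] := m_unit sm; have [v' [p [q [v'0 ->]]]] := gen v.
exists (v' + (q * w) *: (u - u')), (p - q * w * r); split.
  apply: rpredD; first exact: sub01.
  by apply/rpredZ/submodB => //; apply: sub01.
have -> : u - u' = r *: g + s *: h by apply/eqP; rewrite subr_eq E -addrA addrC.
rewrite scalerDr !scalerA -[q * w * s]mulrA ws mulr1 -!addrA; congr (_ + _).
by rewrite [RHS]addrCA -scalerDl [LHS]addrC; congr (_ + _ *: _); ring.
Qed.

Lemma span_subproof (g : V) : submod_axiom (fun u => exists r, u = r *: g).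
Proof.
split=> [|a u v [r ->] [s ->]]; first by exists 0; rewrite scale0r.
by exists (a * r + s); rewrite scalerDl scalerA.
Qed.

Lemma zero_subproof : submod_axiom (fun u : V => u = 0).
Proof. by split=> // a u v -> ->; rewrite scaler0 addr0. Qed.

Lemma full_subproof : submod_axiom (fun _ : V => True).
Proof. by []. Qed.

Lemma has_length1 g : (forall u, exists r, u = r *: g) ->
  (forall r, r \in m -> r *: g = 0) -> g <> 0 -> has_length V 1.
Proof.
move=> gen mg g0; split=> [|k [c lt]].
  exists (fun i => if i is 0 then submod_of zero_subproof else submod_of full_subproof).
  case=> // _; split=> [u _|]; first exact/submod_ofP.
  by move=> /(_ g (introT (submod_ofP full_subproof g) Logic.I)) /submod_ofP.
apply: (chain_le1 (g := g) lt) => [r /mg ->|u]; first exact: rpred0.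
by have [r ->] := gen u; exists 0, r; rewrite rpred0 add0r.
Qed.

Lemma has_length2 g h : (forall u, exists r s, u = r *: g + s *: h) ->
    (forall r, r \in m -> r *: g = 0 /\ r *: h = 0) ->
    (forall r s, r *: g + s *: h = 0 -> r \in m /\ s \in m) -> has_length V 2.
Proof.
move=> gen mgh free; split=> [|k [c lt]].
  exists (fun i => match i with 0 => submod_of zero_subproof
    | 1 => submod_of (span_subproof g) | _ => submod_of full_subproof end).
  case=> [|[]] // _; split=> [u|].
  - move=> /submod_ofP ->; apply/submod_ofP; exists 0; by rewrite scale0r.
  - have gg : g \in submod_of (span_subproof g) by apply/submod_ofP; exists 1; rewrite scale1r.
    move=> /(_ g gg) /submod_ofP g0; have [] := free 1 0; last by rewrite (negPf m1).
    by rewrite scale1r scale0r addr0.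
  - by move=> _; apply/submod_ofP.
  - move=> /(_ h (introT (submod_ofP full_subproof h) Logic.I)) /submod_ofP [r hr].
    have [] := free (- r) 1; last by rewrite (negPf m1).
    by rewrite scale1r scaleNr hr addNr.
apply: (chain_le2 (g := g) (h := h) lt) => [r /mgh [-> ->]|u]; first by rewrite rpred0.
by have [r [s ->]] := gen u; exists 0, r, s; rewrite rpred0 add0r.
Qed.

End Chains.

Lemma has_length_inj (V : lmodType A) k k' : has_length V k -> has_length V k' -> k = k'.
Proof. by move=> [c le] [c' le']; apply/eqP; rewrite eqn_leq le ?le'. Qed.

Section Subquotient.
Variables I Q : ideal A.

Definition subquot_pi t (It : t \in I) : subquot I Q := modpi _ (exist _ t It : submodule I).

Lemma subquot_pi_surj (u : subquot I Q) : exists t (It : t \in I), u = subquot_pi It.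
Proof. by have [[t It] ->] := modpi_surj u; exists t, It. Qed.

Lemma subquot_pi_eq t t' (It : t \in I) (It' : t' \in I) :
  subquot_pi It = subquot_pi It' <-> t - t' \in Q.
Proof.
rewrite /subquot_pi modpi_eq; split.
  by move=> /submod_ofP.
by move=> Qt; apply/submod_ofP.
Qed.

Lemma subquot_piZ r t (It : t \in I) (Irt : r * t \in I) :
  r *: subquot_pi It = subquot_pi Irt.
Proof.
rewrite /subquot_pi -linearZ /=; apply/subquot_pi_eq; by rewrite subrr mem0I.
Qed.

Lemma subquot_piD t t' (It : t \in I) (It' : t' \in I) (ID : t + t' \in I) :
  subquot_pi It + subquot_pi It' = subquot_pi ID.
Proof.
rewrite /subquot_pi -raddfD /=; apply/subquot_pi_eq; by rewrite subrr mem0I.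
Qed.

Lemma subquot_pi0 t (It : t \in I) : subquot_pi It = 0 <-> t \in Q.
Proof.
have <- : subquot_pi (mem0I I) = 0.
  by rewrite /subquot_pi -(raddf0 (@modpi _ _ (traceN I Q))); apply/subquot_pi_eq; rewrite subrr mem0I.
by rewrite subquot_pi_eq subr0.
Qed.

Lemma subquot_length1 w : w \in I -> w \notin Q -> (forall r, r \in m -> r * w \in Q) ->
  (forall t, t \in I -> exists q r, q \in Q /\ t = q + r * w) -> has_length (subquot I Q) 1.
Proof.
move=> Iw Qw mw gen; apply: (has_length1 (g := subquot_pi Iw)) => [u|r /mw Qrw|].
- have [t [It ->]] := subquot_pi_surj u; have [q [r [Qq E]]] := gen t It.
  exists r; rewrite (subquot_piZ Iw (memMl r Iw)); apply/subquot_pi_eq.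
  by rewrite E addrK.
- by rewrite (subquot_piZ Iw (memMl r Iw)); apply/subquot_pi0.
- by move=> /subquot_pi0; apply/negP.
Qed.

Lemma subquot_length2 w c : w \in I -> c \in I ->
    (forall r, r \in m -> r * w \in Q /\ r * c \in Q) ->
    (forall r s, r * w + s * c \in Q -> r \in m /\ s \in m) ->
    (forall t, t \in I -> exists q r s, q \in Q /\ t = q + r * w + s * c) ->
  has_length (subquot I Q) 2.
Proof.
move=> Iw Ic mwc free gen.
have comb r s : r *: subquot_pi Iw + s *: subquot_pi Ic =
    subquot_pi (memDI (memMl r Iw) (memMl s Ic)).
  rewrite (subquot_piZ Iw (memMl r Iw)) (subquot_piZ Ic (memMl s Ic)).
  exact: subquot_piD.
apply: (has_length2 (g := subquot_pi Iw) (h := subquot_pi Ic)) => [u|r /mwc [Qw Qc]|r s].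
- have [t [It ->]] := subquot_pi_surj u; have [q [r [s [Qq E]]]] := gen t It.
  exists r, s; rewrite comb; apply/subquot_pi_eq.
  by rewrite E (_ : _ - _ = q) //; ring.
- by rewrite (subquot_piZ Iw (memMl r Iw)) (subquot_piZ Ic (memMl r Ic)) !subquot_pi0.
- by rewrite comb => /subquot_pi0 /free.
Qed.

End Subquotient.
End SocleLength.

(** * The ideal [I = Q : m] and its square *)

(* [l.+1] and [e.+1] are the exponents [l] and [e] of the header. *)
Section SocleIdeal.
Variables (A : comPzRingType) (m Q : ideal A).
Implicit Types (f g h q r s t : A).
Hypothesis m1 : 1 \notin m.
Hypothesis m_unit : forall t, t \notin m -> exists v, v * t = 1.
Variables (x y z a1 a2 b1 b2 : A) (l e : nat).
Hypothesis mE : m =i genI [:: x; y; z].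
Hypothesis xyz : x ^+ l.+1 * y = 0 /\ x ^+ l.+1 * z = 0.
Let a := x ^+ e.+1 + a1 * y + a2 * z.
Let b := b1 * y + b2 * z.
Let delta := a1 * b2 - a2 * b1.
Let w := x ^+ (l.+1 + e).
Let I := colonI Q m.
Hypothesis QE : Q =i genI [:: a; b].
Hypothesis xYZ : forall g, x * g \in genI [:: y; z] -> g \in genI [:: y; z].
(** As [x ^+ l.+1] kills [y] and [z], this says that the multiples of [x ^+ l.+1] in [Q] are
    multiples of [x ^+ l.+1 * a]. *)
Hypothesis Q_capX : forall g, x ^+ l.+1 * g \in Q ->
  exists h, g - x ^+ e.+1 * h \in genI [:: y; z].
Hypothesis I_socle : forall t, t \in I ->
  exists la f q, q \in Q /\ t = la * (x ^+ l * delta) + x ^+ l.+1 * f + q.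
Hypothesis socle_notinQ : forall f, x ^+ l * delta - x ^+ l.+1 * f \notin Q.

Let Qa : a \in Q. Proof. by rewrite QE mem_genI // mem_head. Qed.
Let Qb : b \in Q. Proof. by rewrite QE mem_genI // !inE eqxx orbT. Qed.
Let mx : x \in m. Proof. by rewrite mE mem_genI // mem_head. Qed.
Let my : y \in m. Proof. by rewrite mE mem_genI // !inE eqxx orbT. Qed.
Let mz : z \in m. Proof. by rewrite mE mem_genI // !inE eqxx !orbT. Qed.

Lemma mulXL0 g : g \in genI [:: y; z] -> x ^+ l.+1 * g = 0.
Proof.
case: xyz => xy xz /genI2P [p [q ->]].
rewrite (_ : _ * _ = p * (x ^+ l.+1 * y) + q * (x ^+ l.+1 * z)); last by ring.
by rewrite xy xz !mulr0 addr0.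
Qed.

Lemma mem_socle t : t * x \in Q -> t * y \in Q -> t * z \in Q -> t \in I.
Proof.
move=> Qx Qy Qz; apply/colonIP => r; rewrite mE => /genI3P [p [q [s ->]]].
by rewrite !mulrDr !memDI // mulrCA memMl.
Qed.

Lemma Q_sub_socle : {subset Q <= I}.
Proof. by move=> q Qq; apply: mem_socle; apply: memMr. Qed.

Lemma unit_mem (K : ideal A) r t : r \notin m -> r * t \in K -> t \in K.
Proof.
by move=> /m_unit [v vr] Krt; rewrite -[t]mul1r -vr -mulrA; apply: memMl.
Qed.

Lemma mulXL_a : x ^+ l.+1 * a = x * w.
Proof.
case: xyz => xy xz; rewrite /a.
rewrite (_ : _ * _ = x ^+ l.+1 * x ^+ e.+1 + a1 * (x ^+ l.+1 * y) + a2 * (x ^+ l.+1 * z)).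
  by rewrite xy xz !mulr0 !addr0 -exprD -exprS addnS.
by ring.
Qed.

Lemma w_mul0 g : g \in genI [:: y; z] -> w * g = 0.
Proof. by move=> YZg; rewrite /w exprD mulrAC mulXL0 // mul0r. Qed.

Let YZy : y \in genI [:: y; z]. Proof. by rewrite mem_genI // mem_head. Qed.
Let YZz : z \in genI [:: y; z]. Proof. by rewrite mem_genI // !inE eqxx orbT. Qed.

Lemma w_socle : w \in I.
Proof.
apply: mem_socle; last by rewrite w_mul0 // mem0I.
  by rewrite mulrC -mulXL_a; apply: memMl.
by rewrite w_mul0 // mem0I.
Qed.

Lemma mul_wQ r : r \in m -> r * w \in Q.
Proof. by move=> mr; rewrite mulrC; apply: (iffLR (colonIP _ _ _) w_socle). Qed.

Lemma mulX_YZn k g : x ^+ k * g \in genI [:: y; z] -> g \in genI [:: y; z].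
Proof.
elim: k => [|k IHk]; first by rewrite expr0 mul1r.
by rewrite exprS -mulrA => /xYZ /IHk.
Qed.

Lemma YZ_sub_m g : g \in genI [:: y; z] -> g \in m.
Proof. by apply: genI_sub => t; rewrite !inE => /orP [] /eqP ->. Qed.

(** By [Q_capX], [x ^+ e * (1 - x h)] would be in [(y, z)]; cancelling [x ^+ e] would put 1 in
    [m]. *)
Lemma w_notinQ : w \notin Q.
Proof.
apply/negP; rewrite /w exprD => /Q_capX [h].
rewrite exprSr -mulrA -{1}[x ^+ e]mulr1 -mulrBr => /mulX_YZn /YZ_sub_m H.
by move/negP: m1; apply; rewrite (memBIr H); apply: memMr.
Qed.

(** Multiplying by [x] lands in [Q], so [x g = x ^+ e.+1 * h] modulo [(y, z)] by [Q_capX]. After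
    cancelling [x], multiplication by [x ^+ l.+1] kills the error and turns [x ^+ e * h] into
    [h w]. *)
Lemma mulXL_socle g : x ^+ l.+1 * g \in I -> exists h, x ^+ l.+1 * g = h * w.
Proof.
move=> /colonIP /(_ x mx); rewrite -mulrA => /Q_capX [h].
rewrite [g * x]mulrC exprS -mulrA -mulrBr => /xYZ /mulXL0.
rewrite mulrBr => /subr0_eq ->; exists h.
by rewrite mulrA -exprD mulrC.
Qed.

(** Cramer's rule holds with [a - x ^+ e.+1] in place of [a]; the power of [x], times [x ^+ l],
    contributes the multiple of [w]. *)
Lemma mul_socle_y f : (x ^+ l * (delta - x * f)) * y =
  x ^+ l * b2 * a - x ^+ l * a2 * b - b2 * w.
Proof.
have [xy _] := xyz.
have -> : x ^+ l * (delta - x * f) * y = x ^+ l * (delta * y) - x ^+ l.+1 * y * f.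
  by rewrite exprS; ring.
rewrite xy mul0r subr0 /delta /w /a /b addSnnS exprD; ring.
Qed.

Lemma mul_socle_z f : (x ^+ l * (delta - x * f)) * z =
  x ^+ l * a1 * b - x ^+ l * b1 * a + b1 * w.
Proof.
have [_ xz] := xyz.
have -> : x ^+ l * (delta - x * f) * z = x ^+ l * (delta * z) - x ^+ l.+1 * z * f.
  by rewrite exprS; ring.
rewrite xz mul0r subr0 /delta /w /a /b addSnnS exprD; ring.
Qed.

Lemma socle_b12 f : x ^+ l * (delta - x * f) \in I -> b1 \in m /\ b2 \in m.
Proof.
move=> Ic; split.
  apply: contraT => b1m; move/negP: w_notinQ; case; apply: (unit_mem b1m).
  move/colonIP: Ic => /(_ z mz); rewrite mul_socle_z memDIr //.
  by apply: memBI; apply: memMl.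
apply: contraT => b2m; move/negP: w_notinQ; case; apply: (unit_mem b2m).
move/colonIP: Ic => /(_ y my); rewrite mul_socle_y => H.
by rewrite -(memBIr H); apply: memBI; apply: memMl.
Qed.

(** A unit [la] would rescale [t - q] to a lift excluded by [socle_b12]. With [la] in [m], the term
    in [delta] reduces modulo [Q] to multiples of [x ^+ l.+1] and of [w], and [mulXL_socle] leaves
    only [w]. *)
Lemma socle_case1 t : ~ (b1 \in m /\ b2 \in m) -> t \in I ->
  exists q r, q \in Q /\ t = q + r * w.
Proof.
move=> b12 It; have [la [f [q [Qq Et]]]] := I_socle It.
have It' : t - q \in I by apply: memBI => //; apply: Q_sub_socle.
have {}Et : t - q = la * (x ^+ l * delta) + x ^+ l.+1 * f by rewrite Et addrK.
have [mla|/m_unit [v vla]] := boolP (la \in m); last first.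
  case: b12; apply: (@socle_b12 (- v * f)).
  have -> : x ^+ l * (delta - x * (- v * f)) = v * (t - q).
    by rewrite Et -[delta in LHS]mul1r -vla exprS; ring.
  exact: memMl.
move: mla; rewrite mE => /genI3P [p [r [s Ela]]].
have E : t - q = x ^+ l.+1 * (p * delta + f) + (- (r * b2) + s * b1) * w
           + r * (x ^+ l * b2 * a - x ^+ l * a2 * b) + s * (x ^+ l * a1 * b - x ^+ l * b1 * a).
  rewrite Et Ela.
  have -> : (p * x + r * y + s * z) * (x ^+ l * delta) + x ^+ l.+1 * f =
     x ^+ l.+1 * (p * delta + f) + r * (x ^+ l * (delta - x * 0) * y)
     + s * (x ^+ l * (delta - x * 0) * z) by rewrite exprS; ring.
  by rewrite mul_socle_y mul_socle_z; ring.
set q1 := r * (x ^+ l * b2 * a - x ^+ l * a2 * b) in E.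
set q2 := s * (x ^+ l * a1 * b - x ^+ l * b1 * a) in E.
have Qq1 : q1 \in Q by apply/memMl/memBI; apply: memMl.
have Qq2 : q2 \in Q by apply/memMl/memBI; apply: memMl.
have /mulXL_socle [h Eh] : x ^+ l.+1 * (p * delta + f) \in I.
  have -> : x ^+ l.+1 * (p * delta + f) =
      t - q - (- (r * b2) + s * b1) * w - q1 - q2 by rewrite E; ring.
  rewrite !memBI //; try exact: Q_sub_socle.
  exact: (memMl _ w_socle).
exists (q + q1 + q2), (h + (- (r * b2) + s * b1)); split; first by rewrite !memDI.
rewrite -(subrK q t) E Eh; ring.
Qed.

Lemma length_case1 : ~ (b1 \in m /\ b2 \in m) -> has_length (subquot I Q) 1.
Proof.
move=> b12; apply: (subquot_length1 m_unit w_socle w_notinQ mul_wQ) => t.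
exact: socle_case1.
Qed.

Lemma mulQI_sub : {subset mulI Q I <= expI I 2}.
Proof. by apply: mulI_sub => q i /Q_sub_socle Iq Ii; apply: mem_expI2. Qed.

Lemma w_sqr : w * w \in mulI Q I.
Proof.
rewrite (_ : w * w = a * (x ^+ l * w)); first by apply: mem_mulI; rewrite // memMl // w_socle.
have -> : a * (x ^+ l * w) = x ^+ e * (x ^+ l.+1 * a) * x ^+ l.
  by rewrite {1}/w exprD; ring.
rewrite mulXL_a /w !exprD exprS; ring.
Qed.

Lemma sqr_case1 : ~ (b1 \in m /\ b2 \in m) -> expI I 2 =i mulI Q I.
Proof.
move=> b12 t; apply/idP/idP; last exact: mulQI_sub.
apply: expI2_sub => {}t t' /(socle_case1 b12) [q [r [Qq ->]]] It'.
rewrite mulrDl; apply: memDI; first exact: mem_mulI.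
have [q' [r' [Qq' ->]]] := socle_case1 b12 It'.
rewrite mulrDr; apply: memDI.
  by rewrite mulrC; apply: mem_mulI => //; apply: (memMl _ w_socle).
by rewrite mulrACA; apply/memMl/w_sqr.
Qed.

(** * Nonunits [b1] and [b2]: the second socle generator [c] *)

Section CaseTwo.
Variable f : A.
(** Under [YZd] the second factor is in [(y, z)], which [x ^+ l.+1] and [w] annihilate; hence
    [x c = w c = 0]. *)
Let c := x ^+ l * (delta - x * f).
Hypotheses (mb1 : b1 \in m) (mb2 : b2 \in m).
Hypothesis YZd : delta - x * f \in genI [:: y; z].

Lemma mulx_c : x * c = 0.
Proof. by rewrite /c mulrA -exprS mulXL0. Qed.

Lemma c_YZ : c \in genI [:: y; z].
Proof. exact: memMl. Qed.

Lemma c_socle : c \in I.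
Proof.
apply: mem_socle.
- by rewrite mulrC mulx_c mem0I.
- by rewrite mul_socle_y; apply: memBI; [apply: memBI; apply: memMl | apply: mul_wQ].
- by rewrite mul_socle_z; apply: memDI; [apply: memBI; apply: memMl | apply: mul_wQ].
Qed.

Lemma socle_case2 t : t \in I -> exists q r s, q \in Q /\ t = q + r * w + s * c.
Proof.
move=> It; have [la [g [q [Qq Et]]]] := I_socle It.
have E : t - q - la * c = x ^+ l.+1 * (g + la * f) by rewrite Et /c exprS; ring.
have /mulXL_socle [h Eh] : x ^+ l.+1 * (g + la * f) \in I.
  rewrite -E !memBI //; first exact: Q_sub_socle.
  exact: (memMl _ c_socle).
by exists q, h, la; rewrite -Eh -E; split=> //; ring.
Qed.

Lemma length_case2 : has_length (subquot I Q) 2.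
Proof.
have cQ r : r \in m -> r * c \in Q.
  by move=> mr; rewrite mulrC; apply: (iffLR (colonIP _ _ _) c_socle).
apply: (subquot_length2 m1 m_unit w_socle c_socle).
- by move=> r mr; rewrite mul_wQ ?cQ.
- move=> r s Qrs; have ms : s \in m.
    apply: contraT => sm; have [v vs] := m_unit sm.
    (* With [v] inverse to [s], the term [r w] is absorbed into [f]: [v (r w + s c)] is
       [x ^+ l * delta - x ^+ l.+1 * f'] for this new [f']. *)
    have := socle_notinQ (f - v * r * x ^+ e).
    rewrite (_ : _ - _ = v * (r * w + s * c)) ?memMl //.
    have -> : v * (r * w + s * c) = v * r * w + v * s * c by ring.
    by rewrite vs mul1r /c /w exprD exprS; ring.
  split=> //; apply: contraT => rm; move/negP: w_notinQ; case; apply: (unit_mem rm).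
  by rewrite -(@memDIr _ _ (s * c)) ?cQ // addrC.
- exact: socle_case2.
Qed.

(** [I = Q + (w, c)] with [w c = 0] and [w ^ 2] in [Q I], so [c ^ 2] is the only product left. *)
Lemma sqr_case2 : c * c \in mulI Q I -> expI I 2 =i mulI Q I.
Proof.
move=> QIcc t; apply/idP/idP; last exact: mulQI_sub.
have Iwc r s : r * w + s * c \in I.
  by apply: memDI; apply: memMl; [apply: w_socle | apply: c_socle].
apply: expI2_sub => {}t t' /socle_case2 [q [r [s [Qq ->]]]] It'.
rewrite -addrA mulrDl; apply: memDI; first exact: mem_mulI.
have [q' [r' [s' [Qq' ->]]]] := socle_case2 It'.
rewrite -addrA mulrDr; apply: memDI; first by rewrite mulrC; apply: mem_mulI.
have -> : (r * w + s * c) * (r' * w + s' * c) =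
    r * r' * (w * w) + s * s' * (c * c) + (r * s' + s * r') * (w * c) by ring.
rewrite (w_mul0 c_YZ) mulr0 addr0.
by apply: memDI; apply: memMl => //; apply: w_sqr.
Qed.

Lemma sqr_case2_lpos : (0 < l)%N -> expI I 2 =i mulI Q I.
Proof.
move=> l0; apply: sqr_case2; rewrite {1}/c -(prednK l0) exprSr.
rewrite (_ : _ * c = x ^+ l.-1 * (delta - x * f) * (x * c)); last by ring.
by rewrite mulx_c mulr0 mem0I.
Qed.

(* The part of [c ^ 2] outside [(a, b) (a, b, c)] is a multiple of [x] that vanishes in
   [A / (y, z)] up to a multiple of [a ^ 2], hence is a multiple of [a w]. *)
Lemma sqr_case2_l0 al be h : l = 0%N -> delta ^+ 2 = al * a + be * b + x * h ->
    (exists la mu nu k, al = la * delta + mu * a + nu * b + x * k) ->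
    (exists la mu nu k, be = la * delta + mu * a + nu * b + x * k) ->
  expI I 2 =i mulI Q I.
Proof.
move=> l0 E [la [mu [nu [k Eal]]]] [la' [mu' [nu' [k' Ebe]]]]; apply: sqr_case2.
have cE : c = delta - x * f by rewrite /c l0 expr0 mul1r.
(* Replacing [delta] by [c + x f] in [al] and [be] gives elements [p] and [p'] of [I]; the multiples
   of [x] are collected in [g] below. *)
pose p := la * c + mu * a + nu * b; pose p' := la' * c + mu' * a + nu' * b.
have Ip : p \in I.
  by rewrite /p; do 2?apply: memDI; apply: memMl; first exact: c_socle;
    apply: Q_sub_socle.
have Ip' : p' \in I.
  by rewrite /p'; do 2?apply: memDI; apply: memMl; first exact: c_socle;
    apply: Q_sub_socle.
pose g := h - f * (delta + c) + (k + la * f) * a + (k' + la' * f) * b.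
have Ecc : c * c = p * a + p' * b + x * g.
  have -> : c * c = delta ^+ 2 - x * f * (delta + c) by rewrite cE; ring.
  rewrite E Eal Ebe /p /p' /g cE; ring.
have YZb : b \in genI [:: y; z] by apply/genI2P; exists b1, b2.
have [s [YZs Ea]] : exists s, s \in genI [:: y; z] /\ a = x ^+ e.+1 + s.
  by exists (a1 * y + a2 * z); rewrite /a addrA; split=> //; apply/genI2P; exists a1, a2.
(* As [x ^+ e.+1 = a - s], the added term cancels the [mu a ^ 2] coming from [p a]; every remaining
   term has a factor [c], [b] or [s] in [(y, z)]. *)
have /xYZ/mulXL0 : x * (g + mu * (x ^+ e * a)) \in genI [:: y; z].
  have -> : x * (g + mu * (x ^+ e * a)) = c * (c - la * a) - b * (nu * a + p') - mu * s * a.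
    rewrite (_ : _ - _ = c * c - p * a - p' * b + mu * (a - s) * a); last by rewrite /p; ring.
    by rewrite Ecc Ea addrK exprS; ring.
  apply: memBI; last by apply/memMr/memMl.
  by apply: memBI; apply: memMr => //; apply: c_YZ.
rewrite l0 expr1 mulrDr => /eqP; rewrite addr_eq0 => /eqP Exg.
rewrite Ecc Exg; apply: memBI; last first.
  rewrite (_ : _ * _ = a * (mu * w)); last by rewrite /w l0 exprS; ring.
  by apply: mem_mulI => //; apply: (memMl _ w_socle).
by apply: memDI; rewrite mulrC; apply: mem_mulI.
Qed.

Let B := quotring (genI [:: x]).
Let phi : {rmorphism A -> B} := @ringpi A (genI [:: x]).

(** [c ^ 2] is in [Q (Q + (w, c))]. In [B], [w] vanishes and [c] becomes [delta], so [delta ^ 2] is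
    in [QB delta + QB ^ 2]: a quadratic equation of integral dependence. *)
Lemma sqr_integral : l = 0%N -> expI I 2 =i mulI Q I ->
  phi delta \in intclosure (extI phi Q).
Proof.
move=> l0 I2; set QB := extI phi Q.
have phix : phi x = 0.
  by rewrite -(rmorph0 phi); apply/(ringpi_eq (genI [:: x])); rewrite subr0 mem_genI // mem_head.
have QBphi q : q \in Q -> phi q \in QB.
  move=> Qq; apply/mem_submod_of; exists 1%N, (fun=> 1), (fun=> q).
  by split=> //; rewrite big_ord1 mul1r.
pose Pr t := exists2 s, s \in QB & phi t - s * phi delta \in expI QB 2.
have PrP : @submod_axiom A A^o Pr.
  apply: submod_axiomR.
  - by exists 0; rewrite ?mem0I // rmorph0 mul0r subr0 mem0I.
  - move=> t t' [s Qs Es] [s' Qs' Es']; exists (s + s'); first exact: memDI.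
    rewrite rmorphD (_ : _ - _ = phi t - s * phi delta + (phi t' - s' * phi delta)).
      exact: memDI.
    by ring.
  - move=> r t [s Qs Es]; exists (phi r * s); first exact: memMl.
    by rewrite rmorphM -mulrA -mulrBr; apply: memMl.
have /mem_submod_of [s Qs Es] : c * c \in submod_of PrP.
  have : c * c \in mulI Q I by rewrite -I2; apply: mem_expI2; apply: c_socle.
  apply: mulI_sub => q i Qq /socle_case2 [q' [r [t [Qq' ->]]]]; apply/mem_submod_of.
  exists (phi (q * t)); first by apply/QBphi/memMr.
  rewrite (_ : phi (q * (q' + r * w + t * c)) - _ = phi q * phi q').
    by apply: mem_expI2; apply: QBphi.
  have -> : q * (q' + r * w + t * c) =
      q * q' + q * t * delta + x * (q * r * x ^+ e - q * t * f).
    by rewrite /c /w l0 addSn exprS expr0 mul1r; ring.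
  rewrite (rmorphD phi (q * q' + _)) (rmorphD phi (q * q')) (rmorphM phi x) phix.
  by rewrite (rmorphM phi (q * t)) (rmorphM phi q q') mul0r addr0 addrK.
apply/asboolP; exists 2%N => //.
exists (fun i => if i == 1%N then - s else - (phi (c * c) - s * phi delta)).
  case=> [|[|[|]]] // _ /=; last exact: memNI.
  by rewrite expI1; apply: memNI.
rewrite big_ltn // big_nat1 /= expr1 expr0 mulr1.
rewrite (_ : phi (c * c) = phi delta ^+ 2); first by ring.
by rewrite rmorphM /c l0 expr0 mul1r rmorphB rmorphM phix mul0r subr0.
Qed.

End CaseTwo.
End SocleIdeal.

(** * Images of ideals and integral closure *)

Section ImageIdeal.
Variables (R S : comPzRingType) (f : {rmorphism R -> S}).
Hypothesis f_surj : forall y, exists x, y = f x.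
Implicit Types (K : ideal R).

Lemma imI_subproof (K : ideal R) : @submod_axiom S S^o (fun y => exists2 x, x \in K & y = f x).
Proof.
apply: submod_axiomR => [|_ _ [x Kx ->] [x' Kx' ->]|y _ [x Kx ->]].
- by exists 0; rewrite ?rmorph0 ?mem0I.
- by exists (x + x'); rewrite ?rmorphD ?memDI.
- by have [a ->] := f_surj y; exists (a * x); rewrite ?rmorphM ?memMl.
Qed.

Definition imI K : ideal S := submod_of (imI_subproof K).

Lemma mem_imI K x : x \in K -> f x \in imI K.
Proof. by move=> Kx; apply/mem_submod_of; exists x. Qed.

Lemma mem_imIE K x : (forall r, f r = 0 -> r \in K) -> f x \in imI K -> x \in K.
Proof.
move=> kerK /mem_submod_of [x' Kx' E].
by rewrite (@memBIr _ K x x') // kerK // rmorphB E subrr.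
Qed.

Lemma imI_prime K : (forall r, f r = 0 -> r \in K) -> prime_ideal K -> prime_ideal (imI K).
Proof.
move=> kerK [K1 prK]; split.
  by apply/negP; rewrite -(rmorph1 f) => /(mem_imIE kerK); apply/negP.
move=> y y'; have [x ->] := f_surj y; have [x' ->] := f_surj y'.
by rewrite -rmorphM => /(mem_imIE kerK)/prK [] /mem_imI; [left | right].
Qed.

Lemma imI_lt K K' : (forall r, f r = 0 -> r \in K) -> submod_lt K K' ->
  submod_lt (imI K) (imI K').
Proof.
move=> kerK [KK' K'K]; split.
  by move=> y /mem_submod_of [x /KK' K'x ->]; apply: mem_imI.
by move=> H; apply: K'K => x /mem_imI /H /(mem_imIE kerK).
Qed.

Lemma preI_subproof (K : ideal S) : @submod_axiom R R^o (fun x => f x \in K).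
Proof.
apply: submod_axiomR => [|x x' Kx Kx'|a x Kx].
- by rewrite rmorph0 mem0I.
- by rewrite rmorphD memDI.
- by rewrite rmorphM memMl.
Qed.

Definition preI (K : ideal S) : ideal R := submod_of (preI_subproof K).

Lemma mem_preI (K : ideal S) x : x \in preI K <-> f x \in K.
Proof. exact: mem_submod_of. Qed.

Lemma preI_prime (K : ideal S) : prime_ideal K -> prime_ideal (preI K).
Proof.
move=> [K1 prK]; split.
  by apply/negP => /mem_preI; rewrite rmorph1; apply/negP.
by move=> x y /mem_preI; rewrite rmorphM => /prK [] /mem_preI; [left | right].
Qed.

Lemma preI_lt (K K' : ideal S) : submod_lt K K' -> submod_lt (preI K) (preI K').
Proof.
move=> [KK' K'K]; split=> [x /mem_preI /KK' K'x|H]; first exact/mem_preI.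
by apply: K'K => y; have [x ->] := f_surj y; move=> /mem_preI /H /mem_preI.
Qed.

Lemma genI_rmorph (s : seq R) x : x \in genI s -> f x \in genI (map f s).
Proof.
elim: s x => [x /genI_nilP ->|a s IHs x /genI_consP [al [y [/IHs sy ->]]]] /=.
  by rewrite rmorph0 mem0I.
by apply/genI_consP; exists (f al), (f y); rewrite rmorphD rmorphM.
Qed.

Lemma genI_rmorphE (s : seq R) x : (forall r, f r = 0 -> r \in genI s) ->
  f x \in genI (map f s) -> x \in genI s.
Proof.
move=> kers H; apply: (mem_imIE kers); apply: genI_sub H => y /mapP [a sa ->].
exact/mem_imI/mem_genI.
Qed.

(** The chain is contracted to [R] and 0 is put below it; [r0] makes that inclusion strict. *)
Lemma prime_chain_preI d r0 : (forall u v : R, u * v = 0 -> u = 0 \/ v = 0) ->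
  r0 <> 0 -> f r0 = 0 -> prime_chain S d -> prime_chain R d.+1.
Proof.
move=> domR r00 fr0 [p prp ltp].
exists (fun i => if i is j.+1 then preI (p j) else genI [::]).
  case=> [_|i id]; last exact/preI_prime/prp.
  split=> [|u v /genI_nilP /domR [] ->]; [|by left; apply: mem0I|by right; apply: mem0I].
  apply/negP => /genI_nilP R0; have := prp 0%N isT; move=> [] /negP p01 _; apply: p01.
  by rewrite -(rmorph1 f) R0 rmorph0 mem0I.
case=> [_|i id]; last exact/preI_lt/ltp.
split=> [x /genI_nilP ->|H]; first exact: mem0I.
by apply: r00; apply/genI_nilP/H/mem_preI; rewrite fr0 mem0I.
Qed.

End ImageIdeal.

(** * Integral closedness of [(X, a, b)] when [X, a] extend to a regular system of parameters *)

Section IntegrallyClosed.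
Variables (R S : comPzRingType) (n : ideal R) (f : {rmorphism R -> S}).
Hypothesis regR : regular_local_ring n 3.
Hypothesis f_surj : forall y, exists x, y = f x.
Variables X a T b : R.
Hypothesis nXaT : n =i genI [:: X; a; T].
Hypothesis kerf : forall r, f r = 0 -> r \in genI [:: X].
Hypothesis Xab : b \notin genI [:: X; a].
Variable QS : ideal S.
Hypothesis QSE : forall r, f r \in QS <-> r \in genI [:: X; a; b].

(* The elements of order at least [j] in the valuation ring [R / (X, a)]. *)
Let ord j := genI [:: X; a; T ^+ j].

Let ordP j r : r \in ord j <-> exists2 h, r - h * T ^+ j \in genI [:: X; a] & True.
Proof.
split=> [/genI3P [p [q [h ->]]]|[h /genI2P [p [q E]] _]].
  by exists h => //; apply/genI2P; exists p, q; rewrite addrK.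
by apply/genI3P; exists p, q, h; rewrite -E subrK.
Qed.

Let ordM i j r s : r \in ord i -> s \in ord j -> r * s \in ord (i + j).
Proof.
move=> /ordP [h rh _] /ordP [h' sh _]; apply/ordP; exists (h * h') => //.
have -> : r * s - h * h' * T ^+ (i + j) =
    (r - h * T ^+ i) * s + (h * T ^+ i) * (s - h' * T ^+ j) by rewrite exprD; ring.
by apply: memDI; [apply: memMr | apply: memMl].
Qed.

Let ordX j k r : r \in ord j -> r ^+ k \in ord (j * k).
Proof.
move=> rj; elim: k => [|k IHk]; last by rewrite exprS mulnS; apply: ordM.
by rewrite muln0; apply: mem_genI; rewrite !expr0 !inE eqxx !orbT.
Qed.

Let ord_le i j : (i <= j)%N -> {subset ord j <= ord i}.
Proof.
move=> ij r /ordP [h rh _]; apply/ordP; exists (h * T ^+ (j - i)) => //.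
by rewrite -mulrA -exprD subnK.
Qed.

Let ord0 r : r \in ord 0.
Proof. by apply: mem1I; apply: mem_genI; rewrite expr0 !inE eqxx !orbT. Qed.

Lemma memXI_diff (I : ideal R) (u v : R) k : u - v \in I -> u ^+ k - v ^+ k \in I.
Proof. by move=> Iuv; rewrite subrXX; apply: memMr. Qed.

(** In the valuation ring [R / (X, a)], [QS] is the set of elements of order at least [k], the order
    of [b]. If [t] had order [j < k], every term but [t ^+ N] of its equation would have order
    greater than [j N]. *)
Lemma intclosure_param : intclosure QS =i QS.
Proof.
have [_ _ _ [M1 prM] MT] := regular_flag regR nXaT.
have [nX na nT] := gen_max nXaT.
have Mn r : r \in genI [:: X; a] -> r \in n.
  by apply: genI_sub => y; rewrite !inE => /orP [] /eqP ->.
have XM r : r \in genI [:: X] -> r \in genI [:: X; a].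
  by apply: genI_sub => y; rewrite !inE => /eqP ->; apply: mem_genI; rewrite mem_head.
have Mord r j : r \in genI [:: X; a] -> r \in ord j.
  by move=> Mr; apply/ordP; exists 0 => //; rewrite mul0r subr0.
have [k [v [v' [vv Eb]]]] := dvr_form regR nXaT Xab.
have ordQ r : f r \in QS -> r \in ord k.
  move=> /QSE; apply: genI_sub => y; rewrite !inE => /or3P [] /eqP ->.
  - by apply: mem_genI; rewrite mem_head.
  - by apply: mem_genI; rewrite !inE eqxx orbT.
  - by apply/ordP; exists v.
have ord_exp i r : f r \in expI QS i -> r \in ord (k * i).
  move=> fr; apply: (@mem_imIE _ _ f f_surj (ord (k * i))).
    by move=> s /kerf /XM /Mord.
  elim: i {r} (f r) fr => [|i IHi] y; first by rewrite muln0; have [r ->] := f_surj y; rewrite mem_imI.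
  apply: mulI_sub => {}y y' QSy /IHi /mem_submod_of [s os ->].
  have [r E] := f_surj y; rewrite E -rmorphM; apply: mem_imI.
  by rewrite mulnS; apply: ordM => //; apply: ordQ; rewrite -E.
move=> t0; apply/idP/idP => [/asboolP [N N0 [c Qc E]]|Qt]; last first.
  apply/asboolP; exists 1%N => //; exists (fun=> - t0).
    by case=> [|[]] // _; rewrite expI1; apply: memNI.
  by rewrite big_nat1 subnn expr0 expr1 mulr1 subrr.
have [t Et] := f_surj t0; rewrite {t0}Et in E *; apply/QSE.
apply: contrapT => /negP tQ.
have tM : t \notin genI [:: X; a].
  apply: contra tQ; apply: genI_sub => y; rewrite !inE => /orP [] /eqP ->;
  by apply: mem_genI; rewrite !inE eqxx ?orbT.
have [j [u [u' [uu Etu]]]] := dvr_form regR nXaT tM.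
have jk : (j < k)%N.
  rewrite ltnNge; apply: contra tQ => kj.
  have MQ r : r \in genI [:: X; a] -> r \in genI [:: X; a; b].
    apply: genI_sub => y; rewrite !inE => /orP [] /eqP ->;
    by apply: mem_genI; rewrite !inE eqxx ?orbT.
  rewrite (memBIr (MQ _ Etu)) -(subnK kj) exprD.
  have -> : u * (T ^+ (j - k) * T ^+ k) = u * T ^+ (j - k) * v' * (b - (b - v * T ^+ k)).
    by rewrite -[in LHS](mul1r (T ^+ k)) -vv; ring.
  apply: memMl; apply: memBI; last exact: MQ.
  by apply: mem_genI; rewrite !inE eqxx !orbT.
have tj : t \in ord j by apply/ordP; exists u.
have [C EC] : exists C : nat -> R, forall i, c i = f (C i).
  by by have [C EC] := boolp.choice (fun i => f_surj (c i)); exists C.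
have ordtN : t ^+ N \in ord (j * N).+1.
  have : t ^+ N + \sum_(1 <= i < N.+1) C i * t ^+ (N - i) \in ord (j * N).+1.
    apply/Mord/XM/kerf; rewrite -[RHS]E rmorphD rmorphXn rmorph_sum; congr (_ + _).
    by apply: eq_bigr => i _; rewrite rmorphM rmorphXn EC.
  rewrite addrC memDIr //.
  rewrite big_nat_cond; apply: rpred_sum => i; rewrite andbT ltnS => /andP [i1 iN].
  apply: (@ord_le _ (k * i + j * (N - i))); last first.
    apply: ordM; last exact: ordX.
    by apply: ord_exp; rewrite -EC; apply: Qc; rewrite i1.
  rewrite -{1}(subnK iN) mulnDr addnC -addSn leq_add2r.
  by rewrite (leq_trans _ (leq_mul jk (leqnn i))) // mulSn -add1n leq_add2r.
have := memXI_diff N Etu; rewrite exprMn -exprM => HN.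
move: ordtN => /ordP [h Eh _].
(* Comparing with [t ^+ N = u ^+ N * T ^+ (j * N)] would make the unit [u ^+ N] a multiple of [T]
   modulo [(X, a)]. *)
have : (u ^+ N - h * T) * T ^+ (j * N) \in genI [:: X; a].
  have -> : (u ^+ N - h * T) * T ^+ (j * N) =
      t ^+ N - h * T ^+ (j * N).+1 - (t ^+ N - u ^+ N * T ^+ (j * N)).
    by rewrite exprS; ring.
  exact: memBI.
move=> /prM [/Mn H|/(mem_primeX (conj M1 prM)) H]; last by rewrite H in MT.
move/negP: (unit_notin_max regR uu); apply.
apply: (mem_primeX (max_prime regR) (k := N)).
by rewrite (memBIr H); apply: memMl.
Qed.

End IntegrallyClosed.

(** * The quotient by [(X^l) :&: (Y, Z)] *)

Section Quotient.
Variables (R : comPzRingType) (n : ideal R).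
Hypothesis regR : regular_local_ring n 3.
Variables X Y Z : R.
Hypothesis nXYZ : n =i genI [:: X; Y; Z].
Variable l : nat.
Let J := capI (genI [:: X ^+ l.+1]) (genI [:: Y; Z]).
Let A : comPzRingType := quotring J.
Let pi : {rmorphism R -> A} := @ringpi R J.
Let pi_surj : forall t, exists r, t = pi r := @ringpi_surj R J.

Let pi_eq0 r : pi r = 0 <-> r \in J.
Proof. by rewrite -(rmorph0 pi) (ringpi_eq J) subr0. Qed.

Let J_YZ r : r \in J -> r \in genI [:: Y; Z].
Proof. by move=> /capIP []. Qed.

Let J_Xl r : r \in J -> r \in genI [:: X ^+ l.+1].
Proof. by move=> /capIP []. Qed.

Let J_X r : r \in J -> r \in genI [:: X].
Proof.
by move=> /J_Xl /genI1P [g ->]; apply/genI1P; exists (g * X ^+ l); rewrite exprSr mulrA.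
Qed.

Let X_sub r (s : seq R) : r \in genI [:: X] -> X \in s -> r \in genI s.
Proof. by move=> Xr sX; apply: genI_sub Xr => y; rewrite inE => /eqP ->; apply: mem_genI. Qed.

Let X_max r : r \in genI [:: X] -> r \in n.
Proof. by rewrite nXYZ => /X_sub; apply; rewrite mem_head. Qed.

(** A chain in [A] contracts to [R] and can be extended by 0, since [X ^+ l.+1 * Y] is a nonzero
    element of [J]; this bounds the dimension by 2. The images of [(X)], [(X, Y)] and [n] attain
    it. *)
Lemma quot_dim d : has_krull_dim A d -> d = 2%N.
Proof.
have [domR [prX X0] XY prXY XYZ] := regular_flag regR nXYZ.
have [nX nY nZ] := gen_max nXYZ.
move=> [chd led]; apply/eqP; rewrite eqn_leq; apply/andP; split.
  have XY0 : X ^+ l.+1 * Y <> 0.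
    elim: (l.+1) => [|k IHk]; last by rewrite exprS -mulrA => /domR [].
    by rewrite expr0 mul1r => Y0; move: XY; rewrite Y0 mem0I.
  have [_ _ [_ max3] _] := regR; rewrite -ltnS; apply: max3.
  apply: (prime_chain_preI pi_surj domR XY0 _ chd).
  apply/pi_eq0/(mem_capX regR nXYZ); exists Y => //.
  by apply: mem_genI; rewrite mem_head.
apply: led; have kerX r : pi r = 0 -> r \in genI [:: X] by move=> /pi_eq0 /J_X.
have kerXY r : pi r = 0 -> r \in genI [:: X; Y].
  by move=> /kerX /X_sub; apply; rewrite mem_head.
have kern r : pi r = 0 -> r \in n by move=> /kerX /X_max.
exists (fun i => match i with 0 => imI pi_surj (genI [:: X])
  | 1 => imI pi_surj (genI [:: X; Y]) | _ => imI pi_surj n end).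
  by case=> [|[|[|]]] // _; apply: imI_prime => //; apply: max_prime.
have sub s1 s2 : {subset s1 <= s2} -> {subset genI s1 <= genI s2}.
  by move=> s12; apply: genI_sub => r /s12; apply: mem_genI.
case=> [|[|]] // _; apply: imI_lt => //; split.
- by apply: sub => r; rewrite !inE => /eqP ->; rewrite eqxx.
- by move/(_ Y); rewrite (negPf XY) mem_genI ?inE ?eqxx ?orbT // => /(_ isT).
- move=> r; rewrite nXYZ; apply: sub => y; rewrite !inE => /orP [] /eqP ->;
  by rewrite eqxx ?orbT.
- by move/(_ Z nZ); rewrite (negPf XYZ).
Qed.

Section ParamIdeal.
Variables m Q : ideal A.
Hypotheses (maxm : maximal_ideal m) (paramQ : parameter_ideal m Q).

Let kern r : pi r = 0 -> r \in n.
Proof. by move=> /pi_eq0 /J_X /X_max. Qed.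

Lemma mem_max r : pi r \in m <-> r \in n.
Proof.
have [m1 maxm'] := maxm.
have sub_pre s : pi s \in m -> s \in n.
  move=> ms; apply: (proper_sub_max regR (I := preI pi m)); last exact/mem_preI.
  by apply/negP => /mem_preI; rewrite rmorph1; apply/negP.
split=> [|nr]; first exact: sub_pre.
rewrite -(maxm' (imI pi_surj n)); first exact: mem_imI.
  by move=> t; have [s ->] := pi_surj t => /sub_pre; apply: mem_imI.
by apply/negP; rewrite -(rmorph1 pi) => /(mem_imIE kern); apply/negP/(one_notin_max regR).
Qed.

Let m_unit t : t \notin m -> exists v, v * t = 1.
Proof.
have [r ->] := pi_surj t => mr; have [|v vr] := notin_max_unit regR (u := r).
  by apply: contra mr => /mem_max.
by exists (pi v); rewrite -rmorphM vr rmorph1.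
Qed.

Let mE : m =i genI [:: pi X; pi Y; pi Z].
Proof.
have [nX nY nZ] := gen_max nXYZ.
move=> t; apply/idP/idP.
  have [r ->] := pi_surj t => /mem_max; rewrite nXYZ; exact: (genI_rmorph pi).
by apply: genI_sub => y; rewrite !inE => /or3P [] /eqP ->; apply/mem_max.
Qed.

Lemma param_form : exists e (a1 a2 b1 b2 : R),
  let a := X ^+ e.+1 + a1 * Y + a2 * Z in let b := b1 * Y + b2 * Z in
  Q =i genI [:: pi a; pi b] /\
  forall r, r \in n -> exists k, r ^+ k \in genI [:: X; a; b].
Proof.
have [s [/quot_dim s2 sm radQ] Qs] := paramQ.
have [r0 [r1 Es]] : exists r0 r1, s = map pi [:: r0; r1].
  move: s2; case: s {sm radQ Qs} => [|t0 [|t1 []]] // _.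
  by have [r0 ->] := pi_surj t0; have [r1 ->] := pi_surj t1; exists r0, r1.
have nr0 : r0 \in n by apply/mem_max/sm; rewrite Es mem_head.
have nr1 : r1 \in n by apply/mem_max/sm; rewrite Es !inE eqxx orbT.
have rad r : r \in n -> exists k q j, [/\ q \in genI [:: r0; r1], j \in J & r ^+ k = q + j].
  move=> /mem_max /radQ [k]; rewrite Es => H; exists k.
  move: H => /genI2P [al [be]].
  have [al' ->] := pi_surj al; have [be' ->] := pi_surj be.
  rewrite -rmorphXn -!rmorphM -rmorphD => /(ringpi_eq J) Jr.
  exists (al' * r0 + be' * r1), (r ^+ k - (al' * r0 + be' * r1)).
  by split=> //; [apply/genI2P; exists al', be' | rewrite addrC subrK].
have [nX nY nZ] := gen_max nXYZ; have [prYZ XYZ] := genYZ_prime regR nXYZ.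
(* If both lifted generators were in [(Y, Z)], so would be a power of [X], because [J] is contained
   in [(Y, Z)]. *)
have [|e [a1 [a2 [b1 [b2 E]]]]] := normal_form regR nXYZ nr0 nr1.
  move=> [YZ0 YZ1]; move/negP: XYZ; apply.
  have [k [q [j [qr /J_YZ YZj Ek]]]] := rad _ nX; apply: (mem_primeX (k := k) prYZ).
  rewrite Ek; apply: memDI => //; apply: genI_sub qr => y.
  by rewrite !inE => /orP [] /eqP ->.
exists e, a1, a2, b1, b2 => a b; split; last first.
  move=> r /rad [k [q [j [qr /J_X Xj Ek]]]]; exists k; rewrite Ek; apply: memDI.
    move: qr; rewrite E; apply: genI_sub => y sy.
    by apply: mem_genI; rewrite inE sy orbT.
  by apply: X_sub Xj _; rewrite mem_head.
move=> t; rewrite Qs Es -[[:: pi a; pi b]]/(map pi [:: a; b]).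
apply/idP/idP; apply: genI_sub => _ /mapP [y sy ->].
  by apply: (genI_rmorph pi (s := [:: a; b])); rewrite -E; apply: mem_genI.
by apply: (genI_rmorph pi (s := [:: r0; r1])); rewrite E; apply: mem_genI.
Qed.

(** * Transfer of the computations in [R] to [A], and the conclusion *)

Section NormalForm.
Variables (e : nat) (a1 a2 b1 b2 : R).
Let a := X ^+ e.+1 + a1 * Y + a2 * Z.
Let b := b1 * Y + b2 * Z.
Let delta := a1 * b2 - a2 * b1.
Hypothesis QE : Q =i genI [:: pi a; pi b].
Hypothesis radXab : forall r, r \in n -> exists k, r ^+ k \in genI [:: X; a; b].
Let I := colonI Q m.

Let nX : X \in n. Proof. by have [] := gen_max nXYZ. Qed.
Let nY : Y \in n. Proof. by have [] := gen_max nXYZ. Qed.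
Let nZ : Z \in n. Proof. by have [] := gen_max nXYZ. Qed.

Let na : a \in n.
Proof. by rewrite /a !memDI //; [apply: memXI | apply: memMl | apply: memMl]. Qed.

Let nb : b \in n.
Proof. by rewrite /b memDI //; apply: memMl. Qed.

Let m1 : 1 \notin m. Proof. by case: maxm. Qed.

Let pia : pi a = pi X ^+ e.+1 + pi a1 * pi Y + pi a2 * pi Z.
Proof. by rewrite /a !rmorphD !rmorphM rmorphXn. Qed.

Let pib : pi b = pi b1 * pi Y + pi b2 * pi Z.
Proof. by rewrite /b rmorphD !rmorphM. Qed.

Let pid : pi delta = pi a1 * pi b2 - pi a2 * pi b1.
Proof. by rewrite /delta rmorphB !rmorphM. Qed.

Let QE' : Q =i genI [:: pi X ^+ e.+1 + pi a1 * pi Y + pi a2 * pi Z;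
                       pi b1 * pi Y + pi b2 * pi Z].
Proof. by rewrite -pia -pib. Qed.

Let memQ r : pi r \in Q -> exists al be g,
  g \in genI [:: Y; Z] /\ r = al * a + be * b + X ^+ l.+1 * g.
Proof.
rewrite QE => /genI2P [al [be]].
have [al' ->] := pi_surj al; have [be' ->] := pi_surj be.
rewrite -!rmorphM -rmorphD => /(ringpi_eq J) /(mem_capX regR nXYZ) [g YZg Eg].
by exists al', be', g; rewrite -Eg addrC subrK.
Qed.

Let xyz : pi X ^+ l.+1 * pi Y = 0 /\ pi X ^+ l.+1 * pi Z = 0.
Proof.
by split; rewrite -rmorphXn -rmorphM; apply/pi_eq0/(mem_capX regR nXYZ);
  [exists Y | exists Z] => //; apply: mem_genI; rewrite !inE eqxx ?orbT.
Qed.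

Let pi_YZ r : pi r \in genI [:: pi Y; pi Z] -> r \in genI [:: Y; Z].
Proof. by apply: (genI_rmorphE pi_surj (s := [:: Y; Z])) => s /pi_eq0 /J_YZ. Qed.

Let YZ_pi r : r \in genI [:: Y; Z] -> pi r \in genI [:: pi Y; pi Z].
Proof. exact: (genI_rmorph pi (s := [:: Y; Z])). Qed.

Let xYZ (g : A) : pi X * g \in genI [:: pi Y; pi Z] -> g \in genI [:: pi Y; pi Z].
Proof.
have [r ->] := pi_surj g; rewrite -rmorphM => /pi_YZ H; apply: YZ_pi.
by apply: (mulX_YZ regR nXYZ (k := 1)); rewrite expr1.
Qed.

(** A relation modulo [X ^+ l.+1] is Koszul up to multiples of that power, so [r] is in [(a, b)]
    modulo [(Y, Z)], where [a] becomes [X ^+ e.+1] and [b] vanishes. *)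
Let Q_capX (g : A) : pi X ^+ l.+1 * g \in Q ->
  exists h, g - pi X ^+ e.+1 * h \in genI [:: pi Y; pi Z].
Proof.
have [r ->] := pi_surj g; rewrite -rmorphXn -rmorphM => /memQ [al [be [g0 [YZg0 E]]]].
have [|la [/genI1P [al' Eal] /genI1P [be' Ebe]]] :=
    @koszul _ _ regR _ _ _ nXYZ _ _ nb radXab l.+1 al be.
  by apply/genI1P; exists (r - g0); rewrite mulrBl [r * _]mulrC E; ring.
exists (pi al'); rewrite -rmorphXn -rmorphM -rmorphB; apply: YZ_pi.
have YZE : X ^+ l.+1 * (r - (al' * a + be' * b + g0)) = 0.
  rewrite mulrBr E (_ : al = la * b + al' * X ^+ l.+1); last by rewrite -Eal; ring.
  by rewrite (_ : be = be' * X ^+ l.+1 - la * a); [ring | rewrite -Ebe; ring].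
have /(mulX_YZ regR nXYZ) H : X ^+ l.+1 * (r - (al' * a + be' * b + g0)) \in genI [:: Y; Z].
  by rewrite YZE mem0I.
have -> : r - X ^+ e.+1 * al' = r - (al' * a + be' * b + g0) +
    (al' * (a1 * Y + a2 * Z) + be' * b + g0) by rewrite /a; ring.
apply: memDI => //; apply: memDI => //; apply: memDI; apply: memMl; apply/genI2P.
  by exists a1, a2.
by exists b1, b2.
Qed.

Let Q_param r : pi r \in Q -> r \in genI [:: X ^+ l.+1; a; b].
Proof.
by move=> /memQ [al [be [g [_ ->]]]]; apply/genI3P; exists g, al, be; ring.
Qed.

Let I_socle (t : A) : t \in I -> exists la f q, q \in Q /\
  t = la * (pi X ^+ l * (pi a1 * pi b2 - pi a2 * pi b1)) + pi X ^+ l.+1 * f + q.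
Proof.
have [r ->] := pi_surj t; move=> /colonIP Ir.
have [|la [f [al [be ->]]]] := @socle_gen _ _ regR _ _ _ nXYZ e a1 a2 b1 b2 radXab l r.
  by move=> s ns; apply: Q_param; rewrite rmorphM; apply/Ir/mem_max.
exists (pi la), (pi f), (pi (al * a + be * b)); split.
  by rewrite QE; apply: (genI_rmorph pi (s := [:: a; b])); apply/genI2P; exists al, be.
rewrite -pid (rmorphD pi (_ + _)) (rmorphD pi (la * _)) (rmorphM pi la).
by rewrite (rmorphM pi (X ^+ l)) (rmorphM pi (X ^+ l.+1)) !rmorphXn.
Qed.

Let socle_notinQ (f : A) :
  pi X ^+ l * (pi a1 * pi b2 - pi a2 * pi b1) - pi X ^+ l.+1 * f \notin Q.
Proof.
have [r ->] := pi_surj f; rewrite -pid -!rmorphXn -!rmorphM -rmorphB.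
apply/negP => /Q_param H.
move/negP: (@socle_notin _ _ regR _ _ _ nXYZ e a1 a2 b1 b2 radXab l); apply.
rewrite (memBIr (y := X ^+ l.+1 * r)) //.
by apply: memMr; apply: mem_genI; rewrite mem_head.
Qed.

Let B := quotring (genI [:: pi X]).
Let phi : {rmorphism A -> B} := @ringpi A (genI [:: pi X]).
Let QB := extI phi Q.
Let f : {rmorphism R -> B} := phi \o pi.

Let f_surj t : exists r, t = f r.
Proof.
have [t' ->] := @ringpi_surj A (genI [:: pi X]) t.
by have [r ->] := pi_surj t'; exists r.
Qed.

Let kerf r : f r = 0 -> r \in genI [:: X].
Proof.
rewrite -(rmorph0 phi) => /(ringpi_eq (genI [:: pi X])); rewrite subr0.
by apply: (genI_rmorphE pi_surj (s := [:: X])) => s /pi_eq0 /J_X.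
Qed.

Lemma mem_extQ r : f r \in QB <-> r \in genI [:: X; a; b].
Proof.
have fQ t : t \in Q -> phi t \in QB.
  move=> Qt; apply/mem_submod_of; exists 1%N, (fun=> 1), (fun=> t).
  by split=> //; rewrite big_ord1 mul1r.
split=> [/mem_submod_of [k [c [d [Qd E]]]]|/genI3P [p [q [s ->]]]].
  apply: (@mem_imIE _ _ f f_surj (genI [:: X; a; b])).
    by move=> s /kerf /X_sub; apply; rewrite mem_head.
  rewrite E; apply: mem_sumI => i; apply: memMl; have := Qd i.
  have [d' ->] := pi_surj (d i) => /Q_param H; apply: (mem_imI (f := f)).
  apply: genI_sub H => y; rewrite !inE => /or3P [] /eqP ->.
  - by apply: memXI; apply: mem_genI; rewrite mem_head.
  - by apply: mem_genI; rewrite !inE eqxx !orbT.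
  - by apply: mem_genI; rewrite !inE eqxx !orbT.
rewrite (rmorphD f (_ + _)) (rmorphD f (p * X)) (rmorphM f p) (rmorphM f q) (rmorphM f s).
apply: memDI; first (apply: memDI); apply: memMl.
- rewrite (_ : f X = 0) ?mem0I // -(rmorph0 phi).
  by apply/(ringpi_eq (genI [:: pi X])); rewrite subr0 mem_genI // mem_head.
- by apply: fQ; rewrite QE mem_genI // mem_head.
- by apply: fQ; rewrite QE mem_genI // !inE eqxx orbT.
Qed.

Let Xab : b \notin genI [:: X; a].
Proof.
apply/negP => Mb.
have [p0 [p1 [p2 [[_ _ pr2] [_ [s12 _] lt2n] p1X p2a]]]] := prime_flag regR nX na.
have p2X := s12 _ p1X; apply: (rad_notin radXab pr2 lt2n) => //.
by apply: genI_sub Mb => y; rewrite !inE => /orP [] /eqP ->.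
Qed.

(* If [a1] or [a2] is a unit, then [X, a, T] is a regular system of parameters for
   [T = Z] or [T = Y]. *)
Lemma extQ_closed : ~ (a1 \in n /\ a2 \in n) -> QB =i intclosure QB.
Proof.
move=> a12; suff [T nXaT] : exists T, n =i genI [:: X; a; T].
  by move=> t; rewrite (intclosure_param regR f_surj nXaT kerf Xab mem_extQ).
have nsub T : T \in n -> {subset genI [:: X; a; T] <= n}.
  by move=> nT; apply: genI_sub => y; rewrite !inE => /or3P [] /eqP ->.
have [/negP a1n|a1n] := boolP (a1 \notin n); last first.
  have /(notin_max_unit regR) [v va] : a2 \notin n.
    by apply/negP => a2n; apply: a12; split=> //; move: a1n; rewrite negbK.
  exists Y => r; apply/idP/idP; last exact: nsub.
  rewrite nXYZ; apply: genI_sub => y; rewrite !inE => /or3P [] /eqP ->.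
  - by apply: mem_genI; rewrite mem_head.
  - by apply: mem_genI; rewrite !inE eqxx !orbT.
  - apply/genI3P; exists (- v * X ^+ e), v, (- v * a1).
    by rewrite /a -[LHS]mul1r -va exprS; ring.
have [v va] := notin_max_unit regR (introN idP a1n).
exists Z => r; apply/idP/idP; last exact: nsub.
rewrite nXYZ; apply: genI_sub => y; rewrite !inE => /or3P [] /eqP ->.
- by apply: mem_genI; rewrite mem_head.
- apply/genI3P; exists (- v * X ^+ e), v, (- v * a2).
  by rewrite /a -[LHS]mul1r -va exprS; ring.
- by apply: mem_genI; rewrite !inE eqxx !orbT.
Qed.

(** [n ^ 2] and the kernel of [pi] lie in [(X) + n Y + n Z], so [a] also has coefficients in [n] at
    [Y] and [Z]. Modulo [X] two such expressions have coefficients agreeing up to [n], as [(X, Y)]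
    and [(X, Z)] are primes. *)
Lemma coef_max2 : {subset Q <= expI m 2} -> a1 \in n /\ a2 \in n.
Proof.
move=> Qm2; have KP : @submod_axiom R R^o (fun r => exists p t u,
    [/\ t \in n, u \in n & r = p * X + t * Y + u * Z]).
  apply: submod_axiomR => [|_ _ [p [t [u [nt nu ->]]]] [p' [t' [u' [nt' nu' ->]]]]|].
  - by exists 0, 0, 0; rewrite !mul0r !addr0 mem0I.
  - by exists (p + p'), (t + t'), (u + u'); rewrite !memDI //; split=> //; ring.
  - move=> c _ [p [t [u [nt nu ->]]]]; exists (c * p), (c * t), (c * u).
    by rewrite !memMl //; split=> //; ring.
pose K : ideal R := submod_of KP.
have KX r : r \in genI [:: X] -> r \in K.
  move=> /genI1P [p ->]; apply/mem_submod_of; exists p, 0, 0.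
  by rewrite mem0I !mul0r !addr0.
have /mem_submod_of [p [t [u [nt nu E]]]] : a \in K.
  apply: (@mem_imIE _ _ pi pi_surj K) => [r /pi_eq0 /J_X /KX //|].
  have : pi a \in expI m 2 by apply: Qm2; rewrite QE mem_genI // mem_head.
  apply: expI2_sub => y y'; have [r ->] := pi_surj y; have [r' ->] := pi_surj y'.
  rewrite -rmorphM => /mem_max nr /mem_max nr'; apply: mem_imI.
  move: nr'; rewrite nXYZ => /genI3P [p [q [s ->]]]; apply/mem_submod_of.
  by exists (r * p), (r * q), (r * s); split; [apply: memMr | apply: memMr | ring].
have XYZE : (a1 - t) * Y + (a2 - u) * Z = (p - X ^+ e) * X.
  rewrite (_ : _ + _ = a - X ^+ e.+1 - t * Y - u * Z); last by rewrite /a; ring.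
  by rewrite E exprSr; ring.
have coef c T S : perm_eq [:: X; Y; Z] [:: X; S; T] -> c * T \in genI [:: X; S] -> c \in n.
  move=> /(gen_max_perm nXYZ) nXST; have [_ _ _ prXS XST] := regular_flag regR nXST.
  move=> /prXS.2 [|XT]; last by rewrite XT in XST.
  rewrite nXST; apply: genI_sub => y; rewrite inE => yXS; apply: mem_genI.
  by move: yXS; rewrite !inE => /orP [] ->; rewrite ?orbT.
have nat : a1 - t \in n.
  apply: (coef _ Y Z).
    by rewrite -[[:: X; Y; Z]]/([:: X] ++ [:: Y] ++ [:: Z]) perm_cat2l perm_catC.
  apply/genI2P; exists (p - X ^+ e), (- (a2 - u)).
  by rewrite -XYZE; ring.
have nau : a2 - u \in n.
  apply: (coef _ Z Y) => //; apply/genI2P; exists (p - X ^+ e), (- (a1 - t)).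
  by rewrite -XYZE; ring.
by rewrite (memBIr nat) (memBIr nau).
Qed.

Lemma socle_sqr :
  [/\ exists2 k, has_length (subquot I Q) k & (k <= 2)%N,
      expI I 2 =i mulI Q I <->
        [\/ (2 <= l.+1)%N,
            l.+1 = 1%N /\ has_length (subquot I Q) 1 |
            [/\ l.+1 = 1%N, has_length (subquot I Q) 2 & ~ (QB =i intclosure QB)]]
    & (2 <= l.+1)%N \/ (l.+1 = 1%N /\ {subset Q <= expI m 2}) ->
        expI I 2 =i mulI Q I].
Proof.
have [b12|b12] := pselect (pi b1 \in m /\ pi b2 \in m); last first.
  have len := length_case1 m1 m_unit mE xyz QE' xYZ Q_capX I_socle b12.
  have sqr := sqr_case1 m1 m_unit mE xyz QE' xYZ Q_capX I_socle b12.
  split=> //; first by exists 1%N.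
  split=> // _; case: (l) => [|k]; last by apply: Or31.
  exact: Or32.
have [mb1 mb2] := b12.
have [nb1 nb2] : b1 \in n /\ b2 \in n by split; apply/mem_max.
have [g YZg] : exists g, delta - X * g \in genI [:: Y; Z].
  have : delta \in n by apply: memBI; apply: memMl.
  rewrite nXYZ => /genI3P [g [q [s ->]]]; exists g; apply/genI2P; exists q, s; ring.
have {}YZg : pi a1 * pi b2 - pi a2 * pi b1 - pi X * pi g \in genI [:: pi Y; pi Z].
  by rewrite -pid -rmorphM -rmorphB; apply: YZ_pi.
have len := length_case2 m1 m_unit mE xyz QE' xYZ Q_capX I_socle socle_notinQ mb1 mb2 YZg.
have sqr_pos := sqr_case2_lpos mE xyz QE' xYZ Q_capX I_socle mb1 mb2 YZg.
have sqr0 : l = 0%N -> a1 \in n /\ a2 \in n -> expI I 2 =i mulI Q I.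
  move=> l0 [na1 na2].
  have [al [be [h [E [[la [mu [nu [k Eal]]]] [la' [mu' [nu' [k' Ebe]]]]]]]]] :=
    delta_sqr regR nXYZ radXab (And4 na1 na2 nb1 nb2).
  have pi4 p q r s : pi (p * delta + q * a + r * b + X * s) = pi p * pi delta +
      pi q * pi a + pi r * pi b + pi X * pi s.
    rewrite (rmorphD pi (p * delta + q * a + r * b)) (rmorphD pi (p * delta + q * a)).
    by rewrite (rmorphD pi (p * delta)) (rmorphM pi p) (rmorphM pi q) (rmorphM pi r) (rmorphM pi X).
  apply: (sqr_case2_l0 mE xyz QE' xYZ Q_capX I_socle mb1 mb2 YZg
    (al := pi al) (be := pi be) (h := pi h) l0).
  - rewrite -pid -pia -pib -rmorphXn E (rmorphD pi (_ + _)) (rmorphD pi (al * a)).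
    by rewrite (rmorphM pi al) (rmorphM pi be) (rmorphM pi X).
  - by exists (pi la), (pi mu), (pi nu), (pi k); rewrite -pid -pia -pib Eal pi4.
  - by exists (pi la'), (pi mu'), (pi nu'), (pi k'); rewrite -pid -pia -pib Ebe pi4.
split; first by exists 2%N.
  split=> [I2|].
    have [l0|] := posnP l; last by move=> ?; apply: Or31.
    apply: Or33; split=> //; first by rewrite l0.
    (* If [QB] were integrally closed, [delta] would be in [(X, a, b)], against [socle_notin] with
       exponent 0. *)
    move=> closed.
    have := sqr_integral mE xyz QE' xYZ Q_capX I_socle mb1 mb2 YZg l0 I2.
    rewrite -pid -/phi -/QB -closed => /mem_extQ.
    have := @socle_notin _ _ regR _ _ _ nXYZ e a1 a2 b1 b2 radXab 0.
    by rewrite expr0 mul1r expr1 => /negP.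
  (* The length is 2, which excludes the second condition; in the third, [extQ_closed] forces [a1]
     and [a2] into [n]. *)
  case=> [/sqr_pos //|[_ /(has_length_inj len)]//|[[l0] _ nclosed]].
  apply: sqr0 => //; apply: contrapT => a12; apply: nclosed; exact: extQ_closed.
case=> [/sqr_pos //|[[l0] /coef_max2]]; exact: sqr0.
Qed.

End NormalForm.
End ParamIdeal.
End Quotient.

Theorem mainTheorem12
    (R : comPzRingType) (n : ideal R) (X Y Z : R) (l : nat)
    (regR : regular_local_ring n 3) (nXYZ : n =i genI [:: X; Y; Z])
    (l_gt0 : (1 <= l)%N) :
  let J := capI (genI [:: X ^+ l]) (genI [:: Y; Z]) in
  let A := quotring J in
  let x : A := ringpi J X in
  let B := quotring (genI [:: x]) in
  forall (m Q : ideal A), maximal_ideal m -> parameter_ideal m Q ->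
  let I := colonI Q m in
  let QB : ideal B := extI (ringpi (genI [:: x])) Q in
  [/\ exists2 k, has_length (subquot I Q) k & (k <= 2)%N,
      expI I 2 =i mulI Q I <->
        [\/ (2 <= l)%N,
            l = 1%N /\ has_length (subquot I Q) 1 |
            [/\ l = 1%N, has_length (subquot I Q) 2 & ~ (QB =i intclosure QB)]]
    & (2 <= l)%N \/ (l = 1%N /\ {subset Q <= expI m 2}) ->
        expI I 2 =i mulI Q I].
Proof.
case: l l_gt0 => // l _ J A x B m Q maxm paramQ I QB.
have [e [a1 [a2 [b1 [b2 [QE rad]]]]]] := param_form regR nXYZ maxm paramQ.
exact: (socle_sqr regR nXYZ maxm QE rad).
Qed.
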